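(* Let $d\ge2$, $q\in[1,\infty)$ and $r\in[1,\infty]$, and let $\mathcal X$ and $\mathcal Y$ be compact and convex subsets of $\mathbb R^d$. Let $M>0$, $\theta\in(0,1]$, and fix $\tilde\rho$ a probability measure on $\mathcal X$ satisfying $\tilde\rho(B_\eta(x))\le M\eta^{d-1+\theta}$ for every $x\in\mathbb R^d$ and $\eta>0$. Then for any $\rho\in\mathcal P(\mathcal X)$, $\mu\in\mathcal P(\mathcal Y)$, any optimal plan $\gamma_{\rho\to\mu}\in\Gamma(\rho,\mu)$, and every $\gamma\in\Pi(\rho,\mu)$, $$W_q(\gamma_{\rho\to\mu},\gamma)\le C_0\left(\int_{\mathcal X\times\mathcal Y}\|x-y\|^2\,d\gamma-W_2^2(\rho,\mu)\right)^{\frac{\theta}{q(1+\theta)}}+C_1W_r(\rho,\tilde\rho)^{\nu},$$ where $\nu\in(0,1]$ is given by $\nu=\frac{r\theta}{q(r+\theta)}$ if $r<\infty$ and $\nu=\frac\theta q$ if $r=\infty$, and $$C_0^q=D_{\mathcal Y}^{\,q}\left(1+c_dMD_{\mathcal X}^{d-1+\theta}\right)(D_{\mathcal Y}D_{\mathcal X})^{-\frac{\theta}{1+\theta}},\qquad C_1=D_{\mathcal Y}\left(c_dMD_{\mathcal X}^{d-1+\theta}+1\right)^{1/q}D_{\mathcal X}^{-\nu}.$$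
   Context: $\mathcal P(E)$ is the set of Borel probability measures on $E$, and $B_\eta(x)$ is the open Euclidean ball. $D_{\mathcal X}=\operatorname{diam}(\mathcal X)$, $D_{\mathcal Y}=\operatorname{diam}(\mathcal Y)$. $\beta_k$ is the volume of the unit ball of $\mathbb R^k$ and $c_d=\frac43\,\frac{6^d d^2(d+1)\beta_d}{\beta_{d-1}}$. $\Pi(\rho,\mu)$ is the set of couplings (transport plans) of $\rho$ and $\mu$, and $\Gamma(\rho,\mu)$ is the set of minimisers of $\int\|x-y\|^2\,d\gamma(x,y)$ over $\gamma\in\Pi(\rho,\mu)$ (optimal plans). For $r\in[1,\infty]$ and measures on $\mathbb R^d$, $W_r(\rho,\mu)=\min_{\gamma\in\Pi(\rho,\mu)}\|x-y\|_{L^r(\gamma)}$. For probability measures $\gamma_0,\gamma_1$ on $\mathbb R^d\times\mathbb R^d$, $W_q^q(\gamma_0,\gamma_1)=\inf_{\pi\in\Pi(\gamma_0,\gamma_1)}\int\|x_0-x_1\|^q+\|y_0-y_1\|^q\,d\pi(x_0,y_0,x_1,y_1)$. *)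

(* Defs.v *)
From HB Require Import structures.
From mathcomp Require Import all_boot all_order all_algebra.
From mathcomp Require Import all_classical all_reals all_analysis.

Set Implicit Arguments.
Unset Strict Implicit.
Unset Printing Implicit Defensive.

Import Order.TTheory GRing.Theory Num.Theory.
Import numFieldNormedType.Exports.

Local Open Scope classical_set_scope.
Local Open Scope ring_scope.

(* R^d is 'rV[R]_d with the Borel sigma-algebra of its topology.  The norm of
   the library on 'rV[R]_d is the sup norm: it gives the right topology, but
   distances below are Euclidean. *)
HB.instance Definition _ (R : realType) (m n : nat) :=
  @isMeasurable.Build (sigma_display (@open 'M[R]_(m, n))) 'M[R]_(m, n)
    <<s @open 'M[R]_(m, n) >>
    (@sigma_algebra0 _ setT _) (@sigma_algebraC _ _)
    (@sigma_algebra_bigcup _ setT _).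

Section Euclidean.
Context {R : realType}.

Definition enorm {d : nat} (x : 'rV[R]_d) : R :=
  Num.sqrt (\sum_(i < d) x 0 i ^+ 2).

Definition eball {d : nat} (x : 'rV[R]_d) (eta : R) : set 'rV[R]_d :=
  [set y | enorm (y - x) < eta].

Definition diam {d : nat} (A : set 'rV[R]_d) : R :=
  sup [set enorm (z.1 - z.2) | z in A `*` A].

(* Lebesgue measure on R^d, as the d-fold product of the one-dimensional one *)
Fixpoint lebesgue_rV (d : nat) : set 'rV[R]_d -> \bar R :=
  match d return set 'rV[R]_d -> \bar R with
  | 0%N => \d_(0 : 'rV[R]_0)
  | k.+1 => pushforward (@lebesgue_measure R \x @lebesgue_rV k)%E
              (fun z : R * 'rV[R]_k => row_mx z.1%:M z.2 : 'rV[R]_(1 + k))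
  end.

Definition beta (k : nat) : R := fine (lebesgue_rV (eball (0 : 'rV[R]_k) 1)).

Definition c_const (d : nat) : R :=
  4 / 3 * (6 ^+ d * d%:R ^+ 2 * (d%:R + 1) * beta d / beta d.-1).

End Euclidean.

Section Couplings.
Context {R : realType} d1 d2 (T1 : measurableType d1) (T2 : measurableType d2).

(* An equality of measures is an equality on measurable sets only. *)
Definition couplings (rho : probability T1 R) (mu : probability T2 R) :
    set (probability (T1 * T2)%type R) :=
  [set gamma |
    (forall A, measurable A -> pushforward gamma fst A = rho A) /\
    (forall B, measurable B -> pushforward gamma snd B = mu B)].

End Couplings.

Section Transport.
Context {R : realType} {d : nat}.
Local Notation E := 'rV[R]_d.
Local Open Scope ereal_scope.

(* Elements of P(A) are represented by their extensions by zero to R^d. *)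
Definition prob_on (A : set E) : set (probability E R) :=
  [set rho | rho A = 1].

Definition quad_cost (gamma : probability (E * E)%type R) : \bar R :=
  \int[gamma]_z (enorm (z.1 - z.2) ^+ 2)%:E.

Definition optimal_plans (rho mu : probability E R) :
    set (probability (E * E)%type R) :=
  [set gamma | couplings rho mu gamma /\
    forall gamma', couplings rho mu gamma' -> quad_cost gamma <= quad_cost gamma'].

Definition W (r : \bar R) (rho mu : probability E R) : \bar R :=
  ereal_inf [set 'N[gamma]_r[(fun z : E * E => (enorm (z.1 - z.2))%:E)]
            | gamma in couplings rho mu].

Definition W_plans (q : R) (gamma0 gamma1 : probability (E * E)%type R) : \bar R :=
  ereal_inf
    [set \int[pi]_z (enorm (z.1.1 - z.2.1) `^ q + enorm (z.1.2 - z.2.2) `^ q)%R%:E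
    | pi in couplings gamma0 gamma1] `^ q^-1.

End Transport.

Section Constants.
Context {R : realType}.
Implicit Types (DX DY M theta q : R).

Definition nu_exp (q theta : R) (r : \bar R) : R :=
  match r with
  | r'%:E => r' * theta / (q * (r' + theta))
  | _ => theta / q
  end.

Definition C0_const (d : nat) q theta M DX DY : R :=
  (DY `^ q * (1 + c_const d * M * DX `^ (d%:R - 1 + theta))
     * (DY * DX) `^ (- (theta / (1 + theta)))) `^ q^-1.

Definition C1_const (d : nat) q theta M DX DY (r : \bar R) : R :=
  DY * (c_const d * M * DX `^ (d%:R - 1 + theta) + 1) `^ q^-1
     * DX `^ (- nu_exp q theta r).

End Constants.

(* Main.v *)
Require Import Defs.
From HB Require Import structures.
From mathcomp Require Import all_boot all_order all_algebra.
From mathcomp Require Import all_classical all_reals all_analysis.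
From mathcomp Require Import measurable_realfun ess_sup_inf ring lra.

(** The plan [gamma] is compared with the optimal plan through Kantorovich
    potentials. Optimality makes the support of the optimal plan cyclically
    monotone ([optimal_plan_cyclically_monotone]), so [rockafellar] yields a
    convex [phi] and a function [psi] whose duality gap
    [phi x + psi y - dot x y] is nonnegative for [y] in Y and vanishes almost
    everywhere for the optimal plan. Since |x - y|^2 is twice the gap plus a
    function of x plus a function of y, the excess cost of [gamma] is twice the
    integral of the gap against [gamma] ([quad_cost_gap]).

    The two plans share their first marginal, and can be coupled so that their
    first components nearly coincide ([glue_plans]). At such a point x, let y
    and y' be the second components. Moving x by eta in the directions of y - y'
    and y' - y shows that eta |y - y'| is at most the gap plus the second
    difference [osc2] of [phi] at scale eta ([dist_le_gap_osc2]). Since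
    |y - y'| is also at most the diameter DY of Y, integrating gives
    ([plan_distance_le])
      W_q^q <= DY^(q-1) (gap integral / eta + integral of min (DY, osc2 / eta)),
    where the last integral is against [rho].

    A subgradient can jump on a set of dimension d - 1, which [rho] may charge,
    but which a measure with balls of mass at most M eta^(d-1+theta) cannot.
    Convexity bounds [osc2] near a point by an average over a ball of radius
    eta of second differences along the axes ([osc2_le_diff2]); their integral
    over a large ball telescopes and leaves only a boundary layer
    ([integral_diff2]). Along a coupling of [rho] with [rhot], this bounds the
    pairs at distance at most eta by the small-ball hypothesis, while the
    others contribute DY times their mass ([integral_osc2]). With the volume
    count [volume_count] the constants collapse into [c_const]
    ([osc2_integral_le]).

    The mass of the pairs farther apart than eta is controlled by Chebyshev's
    inequality, or vanishes for the essential supremum norm and eta large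
    enough ([far_pairs_Lnorm]). It remains to choose eta ([optimise_scale]), to
    take a q-th root, and to pass to the infimum over the couplings of [rho]
    and [rhot]. A set Y of diameter zero, for which the choice of eta makes no
    sense, is treated by letting eta tend to infinity
    ([W_plans_degenerate]). *)

Set Implicit Arguments.
Unset Strict Implicit.
Unset Printing Implicit Defensive.

Import Order.TTheory GRing.Theory Num.Theory.
Import numFieldNormedType.Exports.

Local Open Scope classical_set_scope.
Local Open Scope ring_scope.

(** * Euclidean geometry *)

Section Euclid.
Context {R : realType} {n : nat}.
Implicit Types (x y z : 'rV[R]_n) (a : R).

Definition dot x y : R := \sum_(i < n) x 0 i * y 0 i.

Lemma dotDl x y z : dot (x + y) z = dot x z + dot y z.
Proof. by rewrite -big_split; apply: eq_bigr => i _; rewrite mxE mulrDl. Qed.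

Lemma dotC x y : dot x y = dot y x.
Proof. by apply: eq_bigr => i _; rewrite mulrC. Qed.

Lemma dotDr x y z : dot z (x + y) = dot z x + dot z y.
Proof. by rewrite ![dot z _]dotC dotDl. Qed.

Lemma dotZl a x y : dot (a *: x) y = a * dot x y.
Proof. by rewrite mulr_sumr; apply: eq_bigr => i _; rewrite mxE mulrA. Qed.

Lemma dotZr a x y : dot x (a *: y) = a * dot x y.
Proof. by rewrite dotC dotZl dotC. Qed.

Lemma dotNl x y : dot (- x) y = - dot x y.
Proof. by rewrite -scaleN1r dotZl mulN1r. Qed.

Lemma dotNr x y : dot x (- y) = - dot x y.
Proof. by rewrite dotC dotNl dotC. Qed.

Lemma dotBl x y z : dot (x - y) z = dot x z - dot y z.
Proof. by rewrite dotDl dotNl. Qed.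

Lemma dotBr x y z : dot z (x - y) = dot z x - dot z y.
Proof. by rewrite dotDr dotNr. Qed.

Lemma dot0l x : dot 0 x = 0.
Proof. by rewrite -(scale0r 0) dotZl mul0r. Qed.

Lemma dotxx_ge0 x : 0 <= dot x x.
Proof. by apply: sumr_ge0 => i _; rewrite -expr2 sqr_ge0. Qed.

Lemma enormE x : enorm x = Num.sqrt (dot x x).
Proof. by rewrite /enorm; congr Num.sqrt; apply: eq_bigr => i _; rewrite expr2. Qed.

Lemma enorm_ge0 x : 0 <= enorm x.
Proof. exact: sqrtr_ge0. Qed.

Lemma sqr_enorm x : enorm x ^+ 2 = dot x x.
Proof. by rewrite enormE sqr_sqrtr// dotxx_ge0. Qed.

Lemma enorm0 : enorm (0 : 'rV[R]_n) = 0.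
Proof. by rewrite enormE dot0l sqrtr0. Qed.

Lemma enormN x : enorm (- x) = enorm x.
Proof. by rewrite !enormE dotNl dotNr opprK. Qed.

Lemma enormBC x y : enorm (x - y) = enorm (y - x).
Proof. by rewrite -enormN opprB. Qed.

Lemma enormZ a x : enorm (a *: x) = `|a| * enorm x.
Proof.
by rewrite !enormE dotZl dotZr mulrA -expr2 sqrtrM ?sqr_ge0// sqrtr_sqr.
Qed.

Lemma coord_le_enorm x i : `|x 0 i| <= enorm x.
Proof.
rewrite -sqrtr_sqr enormE ler_sqrt ?dotxx_ge0// /dot (bigD1 i)//= -expr2 lerDl.
by apply: sumr_ge0 => j _; rewrite -expr2 sqr_ge0.
Qed.

Lemma cauchy_schwarz x y : dot x y <= enorm x * enorm y.
Proof.
have [y0|y0] := eqVneq (dot y y) 0.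
  have -> : dot x y = 0; last by rewrite mulr_ge0// enorm_ge0.
  apply: big1 => i _; have : `|y 0 i| <= 0.
    by rewrite (le_trans (coord_le_enorm y i))// enormE y0 sqrtr0.
  by rewrite normr_le0 => /eqP ->; rewrite mulr0.
have yp : 0 < dot y y by rewrite lt_neqAle eq_sym y0 dotxx_ge0.
(* the component of [x] orthogonal to [y], scaled to avoid a division *)
have := dotxx_ge0 (dot y y *: x - dot x y *: y).
rewrite dotBl !dotBr !dotZl !dotZr (dotC y x).
rewrite (_ : _ - _ = dot y y * (dot x x * dot y y - dot x y ^+ 2)); last by ring.
rewrite pmulr_rge0// subr_ge0 => h.
rewrite !enormE -sqrtrM ?dotxx_ge0//.
by rewrite (le_trans (ler_norm _))// -sqrtr_sqr ler_sqrt// mulr_ge0// dotxx_ge0.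
Qed.

Lemma dot_norm_le x y : `|dot x y| <= enorm x * enorm y.
Proof.
rewrite ler_norml cauchy_schwarz andbT lerNl -dotNl -(enormN x).
exact: cauchy_schwarz.
Qed.

Lemma enormD x y : enorm (x + y) <= enorm x + enorm y.
Proof.
rewrite -(@ler_pXn2r _ 2)// ?nnegrE ?addr_ge0 ?enorm_ge0//.
rewrite sqr_enorm dotDl !dotDr (dotC y x) sqrrD !sqr_enorm.
have := cauchy_schwarz x y; lra.
Qed.

Lemma enorm_dist_triangle x y z : enorm (x - z) <= enorm (x - y) + enorm (y - z).
Proof. by rewrite (le_trans _ (enormD _ _))// addrA subrK. Qed.

Lemma enorm_le_sum x : enorm x <= \sum_(i < n) `|x 0 i|.
Proof.
have S0 : 0 <= \sum_(i < n) `|x 0 i| by apply: sumr_ge0.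
rewrite -(@ler_pXn2r _ 2)// ?nnegrE ?enorm_ge0// sqr_enorm expr2 mulr_suml.
apply: ler_sum => i _; rewrite -expr2 -real_normK ?num_real// expr2.
by apply: ler_wpM2l => //; rewrite (bigD1 i)//= lerDl sumr_ge0.
Qed.

Lemma enorm_le_coord x (e : R) : (forall i, `|x 0 i| <= e) -> enorm x <= n%:R * e.
Proof.
move=> h; rewrite (le_trans (enorm_le_sum x))//.
rewrite (le_trans (ler_sum _ (fun i _ => h i)))//.
by rewrite sumr_const card_ord mulr_natl.
Qed.

End Euclid.

(** * Borel sets and measurable functions on row vectors *)

Section RowVectors.
Context {R : realType}.

Lemma ball_rVP n (x y : 'rV[R]_n) (e : R) : 0 < e ->
  ball x e y <-> forall i, `|x 0 i - y 0 i| < e.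
Proof.
move=> e0; split=> [[_ h] i|h]; first by have := h 0 i.
by split=> // i j; rewrite ord1; exact: h.
Qed.

Lemma rV_open_measurable n (A : set 'rV[R]_n) : open A -> measurable A.
Proof. by move=> oA; exact: sub_sigma_algebra. Qed.

Lemma rV_closed_measurable n (A : set 'rV[R]_n) : closed A -> measurable A.
Proof.
move=> cA; rewrite -(setCK A); apply: measurableC; apply: rV_open_measurable.
exact: closed_openC.
Qed.

Lemma rV_compact_measurable n (A : set 'rV[R]_n) : compact A -> measurable A.
Proof.
by move=> /compact_closed h; apply: rV_closed_measurable; apply: h; exact: norm_hausdorff.
Qed.

Lemma rV_continuous_measurable n (f : 'rV[R]_n -> R) :
  continuous f -> measurable_fun setT f.
Proof.
move=> /continuousP cf; apply: (measurability _ (RGenOpens.measurableE R)).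
move=> _ [_ [a [b ->] <-]]; rewrite setTI; apply: rV_open_measurable.
exact/cf/interval_open.
Qed.

Lemma measurable_coord n (i : 'I_n) :
  measurable_fun setT (fun x : 'rV[R]_n => x 0 i).
Proof. by apply: rV_continuous_measurable; exact: coord_continuous. Qed.

Lemma measurable_comp_coord n d (T : measurableType d) (f : T -> 'rV[R]_n) (i : 'I_n) :
  measurable_fun setT f -> measurable_fun setT (fun t => f t 0 i).
Proof. by move=> mf; apply: (measurableT_comp (measurable_coord i)). Qed.

Lemma bigcup_count_measurable d (T : measurableType d) (I : countType)
    (F : I -> set T) :
  (forall i, measurable (F i)) -> measurable (\bigcup_i F i).
Proof.
move=> mF.
pose G n := if unpickle n is Some i then F i else set0.
have -> : \bigcup_i F i = \bigcup_n G n.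
  apply/seteqP; split=> [x [i _ Fx]|x [n _]].
    by exists (pickle i) => //; rewrite /G pickleK.
  by rewrite /G; case: unpickle => // i Fx; exists i.
by apply: bigcupT_measurable => n; rewrite /G; case: unpickle.
Qed.

Definition ratv n (q : 'rV[rat]_n) : 'rV[R]_n := map_mx ratr q.

Lemma ratv_dense n (x : 'rV[R]_n) (e : R) : 0 < e ->
  exists q, ball x e (ratv q).
Proof.
move=> e0.
have h i : exists q : rat, `|x 0 i - ratr q| < e.
  have [q /itvP qi] := rat_in_itvoo (ltr_pwDr e0 (lexx (x 0 i))).
  exists q; rewrite distrC ger0_norm ?subr_ge0 ?qi//.
  by rewrite ltrBlDl qi.
exists (\row_i projT1 (cid (h i))); apply: ((ball_rVP _ _ e0).2) => i.
by rewrite !mxE; case: cid.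
Qed.

Lemma ball_measurable_preim n d (T : measurableType d) (f : T -> 'rV[R]_n) x e : 0 < e ->
  (forall i, measurable_fun setT (fun t => f t 0 i)) ->
  measurable (f @^-1` ball x e).
Proof.
move=> e0 mf.
have -> : f @^-1` ball x e = \bigcap_(i in [set: 'I_n]) [set t | `|x 0 i - f t 0 i| < e].
  apply/seteqP; split=> t /= h; first by move=> i _ /=; exact: ((ball_rVP _ _ e0).1 h).
  by apply: ((ball_rVP _ _ e0).2) => i; exact: (h i).
apply: fin_bigcap_measurable => // i _.
have m : measurable_fun setT (fun t => `|x 0 i - f t 0 i|).
  by apply: measurableT_comp => //; apply: measurable_funB.
rewrite (_ : [set _ | _] = (fun t => `|x 0 i - f t 0 i|) @^-1` `]-oo, e[%classic); last first.
  by apply/seteqP; split=> t /=; rewrite in_itv.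
by rewrite -[X in measurable X]setTI; exact: m.
Qed.

(** Open sets are countable unions of rational boxes, so coordinates decide
    measurability. *)
Lemma measurable_rV n d (T : measurableType d) (f : T -> 'rV[R]_n) :
  (forall i, measurable_fun setT (fun t => f t 0 i)) -> measurable_fun setT f.
Proof.
move=> mf.
apply: (@measurability _ _ T 'rV[R]_n setT f (@open 'rV[R]_n)) => // _ [U oU <-].
rewrite setTI.
pose F (p : 'rV[rat]_n * nat) := [set t | ball (ratv p.1) p.2.+1%:R^-1 `<=` U
   /\ ball (ratv p.1) p.2.+1%:R^-1 (f t)].
have -> : f @^-1` U = \bigcup_p F p.
  apply/seteqP; split=> [t /= Uft|t [p _ [h1 h2]]]; last exact: h1.
  have /nbhs_ballP[e /= e0 he] : nbhs (f t) U by exact: open_nbhs_nbhs.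
  have [k] := ltr_add_invr (divr_gt0 e0 (ltr0n R 2)); rewrite add0r => hk.
  have k0 : 0 < k.+1%:R^-1 :> R by rewrite invr_gt0.
  have [q hq] := ratv_dense (f t) k0.
  exists (q, k) => //; split; last exact: ball_sym.
  move=> y /= hy; apply: he; apply: (@le_ball _ _ _ (k.+1%:R^-1 + k.+1%:R^-1)).
    by rewrite (splitr e) lerD// ltW.
  exact: ball_triangle hq hy.
apply: bigcup_count_measurable => -[q k].
have [h|h] := pselect (ball (ratv q) k.+1%:R^-1 `<=` U); last first.
  by rewrite (_ : F _ = set0)//; apply/seteqP; split=> // t [].
rewrite (_ : F _ = f @^-1` ball (ratv q) k.+1%:R^-1); last first.
  by apply/seteqP; split=> t; [case|].
by apply: ball_measurable_preim => //; rewrite invr_gt0.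
Qed.

Lemma measurable_enorm n d (T : measurableType d) (f : T -> 'rV[R]_n) :
  measurable_fun setT f -> measurable_fun setT (fun t => enorm (f t)).
Proof.
move=> mf; rewrite /enorm; apply: (measurableT_comp (f := @Num.sqrt R)).
  by apply: continuous_measurable_fun; exact: sqrt_continuous.
apply: measurable_sum => i; apply: measurable_funX; exact: measurable_comp_coord.
Qed.

Lemma measurable_rVD n d (T : measurableType d) (f g : T -> 'rV[R]_n) :
  measurable_fun setT f -> measurable_fun setT g ->
  measurable_fun setT (fun t => f t + g t).
Proof.
move=> mf mg; apply: measurable_rV => i.
rewrite (_ : (fun _ => _) = (fun t => f t 0 i + g t 0 i)); last first.
  by apply/funext => t; rewrite mxE.
by apply: measurable_funD; exact: measurable_comp_coord.
Qed.

Lemma measurable_rVN n d (T : measurableType d) (f : T -> 'rV[R]_n) :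
  measurable_fun setT f -> measurable_fun setT (fun t => - f t).
Proof.
move=> mf; apply: measurable_rV => i.
rewrite (_ : (fun _ => _) = (fun t => - f t 0 i)); last first.
  by apply/funext => t; rewrite mxE.
by apply: measurable_funN; exact: measurable_comp_coord.
Qed.

Lemma measurable_rVB n d (T : measurableType d) (f g : T -> 'rV[R]_n) :
  measurable_fun setT f -> measurable_fun setT g ->
  measurable_fun setT (fun t => f t - g t).
Proof. by move=> mf mg; apply: measurable_rVD => //; exact: measurable_rVN. Qed.

Lemma measurable_dist n :
  measurable_fun setT (fun p : 'rV[R]_n * 'rV[R]_n => enorm (p.1 - p.2)).
Proof. by apply: measurable_enorm; exact: measurable_rVB. Qed.

Lemma eball_measurable n (x : 'rV[R]_n) e : measurable (eball x e).
Proof.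
have m : measurable_fun setT (fun y : 'rV[R]_n => enorm (y - x)).
  by apply: measurable_enorm; apply: measurable_rVB => //; exact: measurable_cst.
rewrite (_ : eball x e = (fun y => enorm (y - x)) @^-1` `]-oo, e[%classic).
  by rewrite -[X in measurable X]setTI; exact: m.
by apply/seteqP; split=> t /=; rewrite in_itv.
Qed.

End RowVectors.

(** * Lebesgue measure on row vectors *)

Lemma measurable_preim d d' (T1 : measurableType d) (T2 : measurableType d')
    (f : T1 -> T2) A :
  measurable_fun setT f -> measurable A -> measurable (f @^-1` A).
Proof. by move=> mf mA; rewrite -[X in measurable X]setTI; exact: mf. Qed.

Section PushforwardMeasure.
Context {R : realType} d d' (T1 : measurableType d) (T2 : measurableType d').

(** [pushforward] is a bare set function; integration needs the bundled
    measure. *)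
Definition pushm (m : {measure set T1 -> \bar R}) (f : T1 -> T2)
    (mf : measurable_fun setT f) : {measure set T2 -> \bar R} :=
  measure_function_pushforward__canonical__measure_function_Measure m mf.

Lemma pushmE m f (mf : measurable_fun setT f) : pushm m mf = pushforward m f :> (set T2 -> \bar R).
Proof. by []. Qed.

Lemma pushforward_sigma_finite (m : {measure set T1 -> \bar R})
    (f : T1 -> T2) (g : T2 -> T1) :
  sigma_finite setT m ->
  measurable_fun setT f -> measurable_fun setT g -> cancel f g ->
  exists m' : {sigma_finite_measure set T2 -> \bar R},
    m' = pushforward m f :> (set T2 -> \bar R).
Proof.
move=> [F FT Foo] mf mg fK.
have sf : sigma_finite setT (pushm m mf).
  exists (fun n => g @^-1` F n); first by rewrite -preimage_bigcup -FT.
  move=> n; have [mFn Fnoo] := Foo n; split; first exact: measurable_preim.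
  rewrite pushmE /pushforward.
  by rewrite (_ : f @^-1` _ = F n)//; apply/seteqP; split=> x /=; rewrite fK.
pose mix := Measure_isSigmaFinite.Build _ _ _ (pushm m mf) sf.
pose m' : {sigma_finite_measure set T2 -> \bar R} :=
  HB.pack (Measure.sort (pushm m mf)) (Measure.class (pushm m mf)) mix.
by exists m'.
Qed.

End PushforwardMeasure.

Lemma product_measure_sigma_finite {R : realType} d d' (T1 : measurableType d)
    (T2 : measurableType d') (m1 : {sigma_finite_measure set T1 -> \bar R})
    (m2 : {sigma_finite_measure set T2 -> \bar R}) :
  sigma_finite setT (m1 \x m2)%E.
Proof.
have /sigma_finiteP[F [TF ndF Foo]] := sigma_finiteT m1.
have /sigma_finiteP[G [TG ndG Goo]] := sigma_finiteT m2.
exists (fun n => F n `*` G n).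
  apply/seteqP; split=> [[x y] _|//].
  have [n _ Fn] : (\bigcup_k F k) x by rewrite -TF.
  have [k _ Gk] : (\bigcup_k G k) y by rewrite -TG.
  exists (maxn n k) => //; split.
    by move: x Fn; exact/subsetPset/ndF/leq_maxl.
  by move: y Gk; exact/subsetPset/ndG/leq_maxr.
move=> k; have [mF Fk] := Foo k; have [mG Gk] := Goo k.
split; first exact: measurableX.
by rewrite product_measure1E// lte_mul_pinfty// ge0_fin_numE.
Qed.

Section LebesgueRV.
Context {R : realType}.

Local Notation RT := (measurableTypeR R).

(** The splitting of R^(k+1) into head and tail along which [lebesgue_rV] is
    defined. The head is typed so that it carries the Borel sets that
    [lebesgue_measure] expects. *)
Definition consv k (z : RT * 'rV[R]_k) : 'rV[R]_k.+1 := row_mx z.1%:M z.2 : 'rV[R]_(1 + k).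
Definition unconsv k (v : 'rV[R]_k.+1) : RT * 'rV[R]_k := ((v 0 0 : RT), rsubmx (v : 'rV[R]_(1 + k))).

Lemma consvK k : cancel (@consv k) (@unconsv k).
Proof.
move=> [t z]; rewrite /unconsv /consv row_mxKr; congr (_, _).
have -> : (0 : 'I_k.+1) = lshift k (0 : 'I_1) by exact/val_inj.
by apply: (etrans (@row_mxEl _ 1 1 k _ _ 0 0)); rewrite mxE eqxx.
Qed.

Lemma consv0 k (z : RT * 'rV[R]_k) : consv z 0 0 = z.1.
Proof. by have /(congr1 fst) := consvK z. Qed.

Lemma consvS k (z : RT * 'rV[R]_k) (i : 'I_k) : consv z 0 (lift 0 i) = z.2 0 i.
Proof.
have -> : lift (0 : 'I_k.+1) i = rshift 1 i by exact/val_inj.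
exact: (@row_mxEr _ 1 1 k _ _ 0 i).
Qed.

Lemma measurable_consv k : measurable_fun setT (@consv k).
Proof.
apply: measurable_rV => i; have [j ->|->] := unliftP 0 i.
  apply: (eq_measurable_fun (fun z : RT * 'rV[R]_k => z.2 0 j)) => [z _|].
    by rewrite consvS.
  exact: measurable_comp_coord.
apply: (eq_measurable_fun (fst : RT * 'rV[R]_k -> R)) => [z _|] //.
by rewrite consv0.
Qed.

Lemma measurable_unconsv k : measurable_fun setT (@unconsv k).
Proof.
apply: measurable_fun_pair; first exact: measurable_coord.
apply: measurable_rV => i.
apply: (eq_measurable_fun (fun v : 'rV[R]_k.+1 => v 0 (lift 0 i))) => [v _|]; last exact: measurable_coord.
by rewrite mxE; congr (v 0 _); exact/val_inj.
Qed.

(** The bundled form of [lebesgue_rV]: the induction must carry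
    sigma-finiteness, without which the next product is not a measure with a
    Fubini theorem. *)
Lemma lebesgue_rV_sigma_finite k :
  exists m : {sigma_finite_measure set 'rV[R]_k -> \bar R},
    m = @lebesgue_rV R k :> (set 'rV[R]_k -> \bar R).
Proof.
elim: k => [|k [m IH]]; first by exists (\d_(0 : 'rV[R]_0)).
rewrite /= -IH.
pose L : {sigma_finite_measure set RT -> \bar R} := @lebesgue_measure R.
have [m' hm'] := pushforward_sigma_finite (product_measure_sigma_finite L m)
  (@measurable_consv k) (@measurable_unconsv k) (@consvK k).
by exists m'.
Qed.

End LebesgueRV.

Section LebesgueScaling.
Context {R : realType}.
Local Notation RT := (measurableTypeR R).
Local Notation L := (@lebesgue_measure R).

(** Both sides are measures that agree on half-open intervals. *)
Lemma lebesgue_measure_affine (a b : R) (A : set RT) : 0 < a -> measurable A ->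
  (a%:E * L [set t : RT | A (a * t + b)%R] = L A)%E.
Proof.
move=> a0 mA.
have ma : measurable_fun setT (fun t : RT => (a * t + b : RT)).
  by apply: measurable_funD => //; apply: measurable_funM.
pose c : {nonneg R} := NngNum (ltW a0).
transitivity (mscale c (pushm L ma) A); first by [].
pose m : {measure set RT -> \bar R} := mscale c (pushm L ma).
apply/esym; have := @lebesgue_measure_unique R m; apply => //.
move=> _ [[x y] /= _ <-].
rewrite /mscale /= /pushforward.
rewrite (_ : _ @^-1` _ = `](x - b) / a, (y - b) / a]%classic); last first.
  apply/seteqP; split => t /=; rewrite !in_itv/=.
    by move=> /andP[h1 h2]; rewrite ltr_pdivrMr// ler_pdivlMr//; apply/andP; split; lra.
  rewrite ltr_pdivrMr// ler_pdivlMr// => /andP[h1 h2]; apply/andP; split; lra.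
rewrite !lebesgue_measure_itv/= !lte_fin ltr_pM2r ?invr_gt0// ltrD2r.
case: ifPn => xy; last by rewrite mule0.
by rewrite -!EFinB -EFinM; congr EFin; field; rewrite gt_eqF.
Qed.

Lemma ge0_integral_affine (a b : R) (g : RT -> \bar R) : 0 < a ->
  measurable_fun setT g -> (forall t, 0 <= g t)%E ->
  (\int[L]_t g (a * t + b)%R = (a^-1)%:E * \int[L]_t g t)%E.
Proof.
move=> a0 mg g0.
have ma : measurable_fun setT (fun t : RT => (a * t + b : RT)).
  by apply: measurable_funD => //; apply: measurable_funM.
have := @ge0_integral_pushforward _ _ _ _ R _ ma L setT g measurableT mg (fun y _ => g0 y).
rewrite preimage_setT /comp => <-.
have a'0 : 0 <= a^-1 by rewrite invr_ge0 ltW.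
pose c : {nonneg R} := NngNum a'0.
rewrite -(@ge0_integral_mscale _ _ _ L setT measurableT c)//.
apply: eq_measure_integral => A mA _.
transitivity ((a^-1)%:E * L A)%E; last by [].
transitivity (L [set t : RT | A (a * t + b)%R]); first by [].
rewrite -(lebesgue_measure_affine b a0 mA).
by rewrite muleA -EFinM mulVf ?gt_eqF// mul1e.
Qed.

End LebesgueScaling.

Section LebesgueRVTheory.
Context {R : realType}.
Local Notation RT := (measurableTypeR R).
Local Notation L := (@lebesgue_measure R).

Definition lebm k : {sigma_finite_measure set 'rV[R]_k -> \bar R} :=
  projT1 (cid (@lebesgue_rV_sigma_finite R k)).

Lemma lebmE k : lebm k = @lebesgue_rV R k :> (set _ -> \bar R).
Proof. by rewrite /lebm; case: cid. Qed.

Lemma lebm0E A : lebm 0 A = \d_(0 : 'rV[R]_0) A.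
Proof. by rewrite lebmE. Qed.

Lemma lebmSE k A : lebm k.+1 A = (\int[L]_t lebm k [set z | A (consv ((t : RT), z))])%E.
Proof.
rewrite lebmE /= -lebmE /pushforward /product_measure1.
apply: eq_integral => t _ /=; congr (lebm k _).
by apply/seteqP; split => z /=; rewrite /xsection/= inE.
Qed.

Lemma measurable_lebm_section k A : measurable A ->
  measurable_fun setT (fun t : RT => lebm k [set z | A (consv (t, z))]).
Proof.
move=> mA.
have mB : measurable ((@consv R k) @^-1` A) by apply: measurable_preim => //; exact: measurable_consv.
have := measurable_fun_xsection (lebm k) mB.
apply: eq_measurable_fun => t _ /=; congr (lebm k _).
by apply/seteqP; split => z /=; rewrite /xsection/= inE.
Qed.

Lemma consv_affine k (a : R) (v : 'rV[R]_k.+1) t z :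
  a *: consv ((t : RT), z) + v = consv ((a * t + (unconsv v).1 : RT), a *: z + (unconsv v).2).
Proof.
apply/rowP => i; have [j ->|->] := unliftP 0 i;
    rewrite [LHS]mxE [X in X + _ = _]mxE.
  rewrite !consvS !mxE; congr (_ + _); congr (v _ _); exact/val_inj.
by rewrite !consv0.
Qed.

Lemma lebm_affine k (a : R) (v : 'rV[R]_k) A : 0 < a -> measurable A ->
  lebm k [set z | A (a *: z + v)] = ((a^-1 ^+ k)%:E * lebm k A)%E.
Proof.
move=> a0; elim: k v A => [|k IH] v A mA.
  rewrite expr0 mul1e; congr (lebm 0 _).
  by apply/seteqP; split => z /=; rewrite !(thinmx0 z) ?(thinmx0 (_ + _)).
have ea t z : a *: consv ((t : RT), z) + v = consv ((a * t + (unconsv v).1 : RT), a *: z + (unconsv v).2).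
  exact: consv_affine.
pose g (t : RT) := lebm k [set w | A (consv (t, w))].
have mg : measurable_fun setT g by exact: measurable_lebm_section.
rewrite !lebmSE.
transitivity (\int[L]_t ((a^-1 ^+ k)%:E * g (a * t + (unconsv v).1)%R))%E.
  apply: eq_integral => t _; rewrite -(IH (unconsv v).2).
    by congr (lebm k _); apply/seteqP; split=> z /=; rewrite ea.
  apply: (@measurable_preim _ _ _ _ (fun w => consv ((a * t + (unconsv v).1 : RT), w))) => //.
  apply: (measurableT_comp (@measurable_consv R k)).
  exact: measurable_fun_pair.
have a'0 : 0 <= a^-1 by rewrite invr_ge0 ltW.
rewrite ge0_integralZl_EFin//; last 2 first.
- apply: (measurableT_comp mg).
  by apply: measurable_funD => //; apply: measurable_funM.
- exact: exprn_ge0.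
by rewrite ge0_integral_affine// muleA -EFinM -exprSr.
Qed.

Lemma lebm_translate k (v : 'rV[R]_k) A : measurable A ->
  lebm k [set z | A (z + v)] = lebm k A.
Proof.
move=> mA; have := lebm_affine v ltr01 mA; rewrite invr1 expr1n mul1e => <-.
by congr (lebm k _); apply/seteqP; split=> z /=; rewrite scale1r.
Qed.

Lemma lebm_eball k (x : 'rV[R]_k) (r : R) : 0 < r ->
  lebm k (eball x r) = ((r ^+ k)%:E * lebm k (eball 0%R 1%R))%E.
Proof.
move=> r0; have := lebm_affine x r0 (eball_measurable x r).
rewrite (_ : [set z | _] = eball 0 1); last first.
  apply/seteqP; split=> z /=; rewrite /eball/= addrK subr0 enormZ gtr0_norm// -{2}(mulr1 r) ltr_pM2l//.
by move=> ->; rewrite muleA -EFinM -exprMn mulfV ?gt_eqF// expr1n mul1e.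
Qed.

Lemma enorm_consv k t (z : 'rV[R]_k) :
  enorm (consv ((t : RT), z)) = Num.sqrt (t ^+ 2 + enorm z ^+ 2).
Proof.
rewrite enormE sqr_enorm /dot big_ord_recl !consv0 -expr2.
by congr (Num.sqrt (_ + _)); apply: eq_bigr => i _; rewrite !consvS.
Qed.

Local Notation unit_vol k := (lebm k (eball 0%R 1%R)).

(** The unit ball of R^(k+1) contains the cylinder of height 1 whose base is
    the ball of radius 1/2 of R^k. *)
Lemma unit_volS_ge k : ((2^-1 ^+ k)%:E * unit_vol k <= unit_vol k.+1)%E.
Proof.
have h0 : 0 < 2^-1 :> R by [].
rewrite -(lebm_eball 0 h0) lebmSE.
have -> : lebm k (eball 0%R 2^-1) = (\int[L]_(t in `](- 2^-1)%R, (2^-1)%R[) lebm k (eball 0%R 2^-1))%E.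
  rewrite integral_cst//= lebesgue_measure_itv/= lte_fin.
  rewrite (_ : - 2^-1 < 2^-1 :> R); last by lra.
  by rewrite -EFinB (_ : 2^-1 - - 2^-1 = 1 :> R) ?mule1//; lra.
rewrite integral_mkcond; apply: ge0_le_integral => //.
- by move=> t _; rewrite patchE; case: ifP.
- apply/(measurable_restrictT _ _).1 => //.
- exact: measurable_lebm_section (eball_measurable _ _).
move=> t _; rewrite patchE; case: ifPn => [|_]; last exact: measure_ge0.
rewrite inE /= in_itv/= => /andP[t1 t2].
apply: le_measure; rewrite ?inE.
- exact: eball_measurable.
- apply: (@measurable_preim _ _ _ _ (fun w => consv ((t : RT), w))); last exact: eball_measurable.
  by apply: (measurableT_comp (@measurable_consv R k)); exact: measurable_fun_pair.
move=> z /=; rewrite /eball/= !subr0 enorm_consv => hz.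
rewrite -sqrtr1 ltr_sqrt//.
have : t ^+ 2 < 2^-1 ^+ 2 by nra.
have := enorm_ge0 z; nra.
Qed.

(** The unit ball of R^(k+1) lies in the cylinder of height 2 over the unit
    ball of R^k. *)
Lemma unit_volS_le k : (unit_vol k.+1 <= 2%:E * unit_vol k)%E.
Proof.
have -> : (2%:E * unit_vol k = \int[L]_(t in `](-1)%R, 1%R[) unit_vol k)%E.
  rewrite integral_cst//= lebesgue_measure_itv/= lte_fin.
  rewrite (_ : - 1 < 1 :> R); last by lra.
  by rewrite -EFinB (_ : 1 - - 1 = 2 :> R) 1?muleC//; lra.
rewrite lebmSE [X in (_ <= X)%E]integral_mkcond; apply: ge0_le_integral => //.
- exact: measurable_lebm_section (eball_measurable _ _).
- apply/(measurable_restrictT _ _).1 => //.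
have bz t (z : 'rV[R]_k) : eball 0 1 (consv ((t : RT), z)) -> t ^+ 2 + enorm z ^+ 2 < 1.
  by rewrite /eball/= subr0 enorm_consv -[X in _ < X -> _]sqrtr1 ltr_sqrt.
have mS t : measurable [set z : 'rV[R]_k | eball 0 1 (consv ((t : RT), z))].
  apply: (@measurable_preim _ _ _ _ (fun w => consv ((t : RT), w))); last exact: eball_measurable.
  by apply: (measurableT_comp (@measurable_consv R k)); exact: measurable_fun_pair.
move=> t _; rewrite patchE; case: ifPn => [_|ht0].
  apply: le_measure; rewrite ?inE//; first exact: eball_measurable.
  move=> z /= /bz; rewrite /eball/= subr0 => h; have := enorm_ge0 z; nra.
have /negP := ht0; rewrite inE/= in_itv/= => ht.
rewrite (_ : [set z | _] = set0) ?measure0//; apply/seteqP; split=> // z /= /bz h.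
apply: ht; have := sqr_ge0 (enorm z); nra.
Qed.

Lemma unit_vol0 : unit_vol 0 = 1%E.
Proof. by rewrite lebm0E diracE mem_set// /eball/= subr0 enorm0. Qed.

Lemma unit_vol_lty k : (unit_vol k < +oo)%E.
Proof.
elim: k => [|k IH]; first by rewrite unit_vol0 ltry.
by rewrite (le_lt_trans (unit_volS_le k))// lte_mul_pinfty.
Qed.

Lemma unit_vol_gt0 k : (0 < unit_vol k)%E.
Proof.
elim: k => [|k IH]; first by rewrite unit_vol0.
by rewrite (lt_le_trans _ (unit_volS_ge k))// mule_gt0.
Qed.

Lemma betaE k : (beta k : R)%:E = unit_vol k.
Proof. by rewrite /beta -lebmE fineK// ge0_fin_numE// unit_vol_lty. Qed.

Lemma beta_gt0 k : 0 < beta k :> R.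
Proof. by rewrite -lte_fin betaE unit_vol_gt0. Qed.

(** The ratio of the volumes of the unit balls of R^d and R^(d-1) is at least
    2^(1-d), so together with the factor 6^d it contributes at least
    6 * 3^(d-1), which is at least 18. This polynomial lower bound is all that
    the volume count below asks of the constant. *)
Lemma c_const_ge d : (2 <= d)%N -> 24 * d%:R ^+ 2 * (d%:R + 1) <= c_const d :> R.
Proof.
case: d => // -[|d] // _; rewrite /c_const.
have := unit_volS_ge d.+1; rewrite -!betaE -EFinM lee_fin /=.
have b0 := beta_gt0 d.+1.
rewrite -ler_pdivlMr// => hb.
set q := beta d.+2 / _ in hb *; rewrite -mulrA.
set n : R := d.+2%:R; have n0 : 0 <= n by exact: ler0n.
have h : 18 <= 6 ^+ d.+2 * q.
  apply: (@le_trans _ _ (6 ^+ d.+2 * 2^-1 ^+ d.+1)); last by rewrite ler_pM2l// exprn_gt0.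
  rewrite exprS -mulrA -exprMn (_ : 6 * 2^-1 = 3 :> R); last by field.
  rewrite exprS (_ : 18 = 6 * (3 * 1)); last by ring.
  by rewrite !ler_pM2l// exprn_ege1// ler1n.
rewrite (_ : 4 / 3 * _ = 6 ^+ d.+2 * q * (4 / 3 * n ^+ 2 * (n + 1))); last by rewrite /q -/n; ring.
rewrite (_ : 24 * _ = 18 * (4 / 3 * n ^+ 2 * (n + 1))); last by field.
by apply: ler_wpM2r => //; rewrite !mulr_ge0// ?sqr_ge0// addr_ge0.
Qed.

End LebesgueRVTheory.

(** * Kantorovich potentials *)

Section Potentials.
Context {R : realType} {n : nat}.
Local Notation E := 'rV[R]_n.

(** With [s = q1, .., qk] this is
    <x - p.1, p.2> + <p.1 - q1.1, q1.2> + ... + <q(k-1).1 - qk.1, qk.2>, so the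
    walk that it sums goes from [qk] through [p] to [x]. Taking for [x] the
    first component of the last pair closes the walk into a cycle. *)
Fixpoint chain (x : E) (p : E * E) (s : seq (E * E)) : R :=
  dot (x - p.1) p.2 + (if s is q :: s' then chain p.1 q s' else 0).

Definition cyclically_monotone (S : set (E * E)) :=
  forall p s, S p -> (forall q, q \in s -> S q) ->
    chain (last p s).1 p s <= 0.

(** [phi x] is the supremum of [dot x y - psi y] over [y] in [Y], so that [phi]
    is convex with slopes in the closed convex hull of [Y]. The supremum is
    expressed by its two defining inequalities, in which form it is used. *)
Definition potential_pair (Y : set E) (phi psi : E -> R) :=
  (forall x y, Y y -> dot x y <= phi x + psi y) /\
  (forall x e, 0 < e -> exists2 y, Y y & phi x <= dot x y - psi y + e).

Lemma chainD x z p s : chain z p s = chain x p s + dot (z - x) p.2.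
Proof.
have e : z - p.1 = (x - p.1) + (z - x) by rewrite [RHS]addrC addrA subrK.
by case: s => [|q s] /=; rewrite e dotDl addrAC.
Qed.

(** The supremum [phi0] of the chains that start at a fixed pair of [S] is
    finite by cyclic monotonicity, and every pair of [S] is a subgradient of
    it. Two Legendre transforms, over [X] and then over [Y], keep this property
    and make the potentials Lipschitz. *)
Theorem rockafellar (X Y : set E) (S : set (E * E)) (BX BY : R) p0 :
  (forall x, X x -> enorm x <= BX) -> (forall y, Y y -> enorm y <= BY) ->
  S `<=` X `*` Y -> S p0 -> cyclically_monotone S ->
  exists phi psi, [/\ potential_pair Y phi psi,
    forall p, S p -> phi p.1 + psi p.2 = dot p.1 p.2 &
    forall y y', psi y - psi y' <= BX * enorm (y - y')].
Proof.
move=> hX hY SXY Sp0 cS.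
pose A x := [set c | exists p s, [/\ S p, forall q, q \in s -> S q, last p s = p0 & c = chain x p s]].
have A0 x : A x !=set0 by exists (chain x p0 [::]), p0, [::].
have ubA x : ubound (A x) (enorm (x - p0.1) * BY).
  move=> _ [p [s [Sp Ss hl ->]]]; rewrite (chainD p0.1).
  have h1 := cS _ _ Sp Ss; rewrite hl in h1.
  have h2 := cauchy_schwarz (x - p0.1) p.2.
  have h3 : enorm (x - p0.1) * enorm p.2 <= enorm (x - p0.1) * BY.
    by rewrite ler_wpM2l ?enorm_ge0//; apply: hY; have [] := SXY _ Sp.
  by rewrite (le_trans _ h3)// (le_trans _ h2)// gerDr.
have supA x : has_sup (A x) by split=> //; exists (enorm (x - p0.1) * BY).
pose phi0 x := sup (A x).
have phi0_ge x p s : S p -> (forall q, q \in s -> S q) -> last p s = p0 -> chain x p s <= phi0 x.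
  by move=> Sp Ss hl; apply: ub_le_sup; [exact: (supA x).2|exists p, s].
have phi0_sub z p : S p -> phi0 p.1 + dot (z - p.1) p.2 <= phi0 z.
  move=> Sp; rewrite -lerBrDr; apply: ge_sup => // _ [q [s [Sq Ss hl ->]]].
  rewrite lerBrDr addrC; apply: (phi0_ge z p (q :: s)) => // q'.
  by rewrite inE => /orP[/eqP ->//|]; exact: Ss.
have X0 : X p0.1 by have [] := SXY _ Sp0.
have Y0 : Y p0.2 by have [] := SXY _ Sp0.
pose B y := [set dot x y - phi0 x | x in X].
have B0 y : B y !=set0 by exists (dot p0.1 y - phi0 p0.1), p0.1.
have supB y : has_sup (B y).
  split=> //; exists (BX * enorm y - phi0 p0.1 + (BX + BX) * BY) => _ [x Xx <-].
  have h1 := phi0_sub x p0 Sp0.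
  have h2 := dot_norm_le (x - p0.1) p0.2.
  have h3 := cauchy_schwarz x y.
  have h4 : enorm x * enorm y <= BX * enorm y by rewrite ler_wpM2r ?enorm_ge0// hX.
  have h5 : enorm (x - p0.1) * enorm p0.2 <= (BX + BX) * BY.
    apply: ler_pM; rewrite ?enorm_ge0 ?hY//.
    by rewrite (le_trans (enormD _ _))// enormN lerD// hX.
  have h6 := ler_norm (- dot (x - p0.1) p0.2); rewrite normrN in h6.
  lra.
pose psi y := sup (B y).
have psi_ge x y : X x -> dot x y - phi0 x <= psi y.
  by move=> Xx; apply: ub_le_sup; [exact: (supB y).2|exists x].
pose C z := [set dot z y - psi y | y in Y].
have C0 z : C z !=set0 by exists (dot z p0.2 - psi p0.2), p0.2.
have supC z : has_sup (C z).
  split=> //; exists (enorm (z - p0.1) * BY + phi0 p0.1) => _ [y Yy <-].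
  have h1 := psi_ge p0.1 y X0.
  have h2 := cauchy_schwarz (z - p0.1) y.
  have h3 : enorm (z - p0.1) * enorm y <= enorm (z - p0.1) * BY.
    by rewrite ler_wpM2l ?enorm_ge0// hY.
  rewrite dotBl in h2; lra.
pose phi z := sup (C z).
exists phi, psi; split.
- split=> [x y Yy|x e e0].
    by rewrite -lerBlDr; apply: ub_le_sup; [exact: (supC x).2|exists y].
  have [_ [y Yy <-] hy] := sup_adherent e0 (supC x).
  by exists y => //; rewrite -lerBlDr ltW.
- move=> [x y] Sp /=; have [/= Xx Yy] := SXY _ Sp.
  apply/eqP; rewrite eq_le; apply/andP; split; last first.
    by rewrite -lerBlDr; apply: ub_le_sup; [exact: (supC x).2|exists y].
  have h1 : phi x <= phi0 x.
    by apply: ge_sup => // _ [y' Yy' <-]; have := psi_ge x y' Xx; lra.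
  have h2 : psi y <= dot x y - phi0 x.
    apply: ge_sup => // _ [x' Xx' <-].
    by have := phi0_sub x' (x, y) Sp; rewrite /= dotBl; lra.
  lra.
- move=> y y'; rewrite lerBlDr; apply: ge_sup => // _ [x Xx <-].
  have h1 := psi_ge x y' Xx; have h2 := cauchy_schwarz x (y - y').
  have h3 : enorm x * enorm (y - y') <= BX * enorm (y - y').
    by rewrite ler_wpM2r ?enorm_ge0// hX.
  rewrite dotBr in h2; lra.
Qed.

End Potentials.

(** * Second differences of a potential *)

Section SecondDifference.
Context {R : realType} {n : nat}.
Local Notation E := 'rV[R]_n.
Variables (Y : set E) (phi psi : E -> R) (BY : R).
Hypothesis hY : forall y, Y y -> enorm y <= BY.
Hypothesis pp : potential_pair Y phi psi.

Lemma potential_lipschitz x z : phi x - phi z <= BY * enorm (x - z).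
Proof.
apply/ler_addgt0Pr => e e0; have [y Yy hy] := pp.2 x e e0.
have h1 := pp.1 z y Yy; have h2 := cauchy_schwarz (x - z) y.
have h3 : enorm (x - z) * enorm y <= enorm (x - z) * BY.
  by rewrite ler_wpM2l ?enorm_ge0// hY.
rewrite dotBl in h2; lra.
Qed.

Definition diff2 (u x : E) : R := phi (x + u) + phi (x - u) - 2 * phi x.

Lemma diff2_ge0 u x : 0 <= diff2 u x.
Proof.
apply/ler_addgt0Pr => e e0; have e20 : 0 < e / 2 by rewrite divr_gt0.
have [y Yy hy] := pp.2 x _ e20; rewrite /diff2.
have h1 := pp.1 (x + u) y Yy; have h2 := pp.1 (x - u) y Yy.
rewrite dotDl in h1; rewrite dotBl in h2; lra.
Qed.

(** The largest symmetric second difference at scale [eta]; for the convex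
    function [phi] it measures how much the subgradients vary within [eta] of
    [x]. *)
Definition osc2 (eta : R) (x : E) : R :=
  sup [set diff2 u x | u in [set u | enorm u <= eta]].

Lemma osc2_has_sup eta x : 0 <= eta ->
  has_sup [set diff2 u x | u in [set u | enorm u <= eta]].
Proof.
move=> eta0; split; first by exists (diff2 0 x), 0 => //=; rewrite enorm0.
exists (BY * eta + BY * eta) => _ [u /= hu <-]; rewrite /diff2.
have h1 := potential_lipschitz (x + u) x; have h2 := potential_lipschitz (x - u) x.
rewrite addrAC subrr add0r in h1; rewrite addrAC subrr add0r enormN in h2.
have [y Yy _] := pp.2 x 1 ltr01.
have BY0 : 0 <= BY by rewrite (le_trans (enorm_ge0 y))// hY.
have h3 : BY * enorm u <= BY * eta by rewrite ler_wpM2l.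
lra.
Qed.

Lemma diff2_le_osc2 eta u x : enorm u <= eta -> diff2 u x <= osc2 eta x.
Proof.
move=> hu; apply: ub_le_sup; last by exists u.
by apply: (osc2_has_sup x _).2; rewrite (le_trans (enorm_ge0 u)).
Qed.

Lemma osc2_ge0 eta x : 0 <= eta -> 0 <= osc2 eta x.
Proof.
by move=> e0; rewrite (le_trans (diff2_ge0 0 x))// diff2_le_osc2// enorm0.
Qed.

Definition gap (x y : E) : R := phi x + psi y - dot x y.

Lemma gap_ge0 x y : Y y -> 0 <= gap x y.
Proof. by move=> Yy; rewrite subr_ge0; exact: pp.1. Qed.

(** Both [y] and [y'] are approximate subgradients of [phi] at [x]; moving
    from [x] by [eta] along their difference in opposite directions detects
    their distance. *)
Lemma dist_le_gap_osc2 eta x y y' : 0 < eta -> Y y -> Y y' ->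
  eta * enorm (y - y') <= gap x y + gap x y' + osc2 eta x.
Proof.
move=> e0 Yy Yy'; have [d0|d0] := eqVneq (enorm (y - y')) 0.
  rewrite d0 mulr0; have := gap_ge0 x Yy; have := gap_ge0 x Yy'.
  by have := osc2_ge0 x (ltW e0); lra.
pose u := (eta / enorm (y - y')) *: (y - y').
have nu : enorm u = eta.
  rewrite enormZ ger0_norm ?divr_ge0 ?enorm_ge0 ?(ltW e0)//.
  by rewrite -mulrA mulVf// mulr1.
have du : dot u (y - y') = eta * enorm (y - y').
  by rewrite dotZl -sqr_enorm expr2 mulrA -(mulrA eta) mulVf// mulr1.
have h : diff2 u x <= osc2 eta x by apply: diff2_le_osc2; rewrite nu.
have h1 := pp.1 (x + u) y Yy; have h2 := pp.1 (x - u) y' Yy'.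
rewrite dotDl in h1; rewrite dotBl in h2; rewrite dotBr in du.
rewrite /gap; rewrite /diff2 in h; lra.
Qed.

Definition axis (r : R) (i : 'I_n) : E := r *: delta_mx 0 i.

Lemma dot_axis r i y : dot (axis r i) y = r * y 0 i.
Proof.
rewrite dotZl; congr (_ * _); rewrite /dot (bigD1 i)//= mxE !eqxx mul1r big1 ?addr0// => j ji.
by rewrite mxE eqxx (negbTE ji) mul0r.
Qed.

Lemma enorm_axis r i : enorm (axis r i) = `|r|.
Proof.
by rewrite enormE dot_axis !mxE !eqxx mulr1 -expr2 sqrtr_sqr.
Qed.

(** [z + w] is a convex combination of [z] and of vertices of the
    cross-polytope of radius [r] around [z]. *)
Lemma potential_cross_polytope (r : R) (z w : E) : 0 < r -> \sum_i `|w 0 i| <= r ->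
  phi (z + w) <= phi z
    + \sum_i (`|w 0 i| / r) * (phi (z + Num.sg (w 0 i) *: axis r i) - phi z).
Proof.
move=> r0 hw; apply/ler_addgt0Pr => e e0.
have [y Yy hy] := pp.2 (z + w) e e0; rewrite (le_trans hy)// lerD2r.
set a := dot z y - psi y.
have az : a <= phi z by rewrite lerBlDr; exact: pp.1.
apply: (@le_trans _ _ (a + \sum_i (`|w 0 i| / r) * (Num.sg (w 0 i) * (r * y 0 i)))).
  rewrite dotDl -addrAC lerD2l /dot le_eqVlt; apply/orP; left; apply/eqP.
  apply: eq_bigr => i _; rewrite [in LHS](numEsg (w 0 i)).
  by field; rewrite gt_eqF.
apply: (@le_trans _ _ (a + \sum_i (`|w 0 i| / r) *
    (phi (z + Num.sg (w 0 i) *: axis r i) - phi z + (phi z - a)))).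
  rewrite lerD2l; apply: ler_sum => i _; apply: ler_wpM2l; first by rewrite divr_ge0// ltW.
  have := pp.1 (z + Num.sg (w 0 i) *: axis r i) y Yy.
  by rewrite dotDl dotZl dot_axis /a; lra.
rewrite -subr_ge0.
under [X in _ - (_ + X)]eq_bigr => i _ do rewrite mulrDr.
rewrite big_split /= -mulr_suml -mulr_suml.
set s := \sum_i _; set t := \sum_i _.
rewrite (_ : phi z + s - _ = (1 - t / r) * (phi z - a)); last by ring.
by rewrite mulr_ge0 ?subr_ge0// ler_pdivrMr// mul1r.
Qed.

(** Subtracting an affine function that supports [phi] at [z] leaves a
    nonnegative convex [f] that vanishes at [z]. Its value at the end of an axis
    is at most the second difference along that axis, and convexity on the
    cross-polytope of radius [3 * n * eta], which contains the ball of radius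
    [3 * eta], bounds [f] near [x] by the average of these values. Supporting
    functions exist only up to an arbitrary error [e]. *)
Lemma osc2_le_diff2 (eta : R) (x z : E) : 0 < eta -> (0 < n)%N -> enorm (x - z) <= 2 * eta ->
  osc2 eta x <= 2 / n%:R * \sum_i diff2 (axis (3 * n%:R * eta) i) z.
Proof.
move=> e0 n0 hxz; have N0 : 0 < n%:R :> R by rewrite ltr0n.
apply: ge_sup; first by have [] := osc2_has_sup x (ltW e0).
move=> _ [u /= hu <-]; apply/ler_addgt0Pr => e e'0.
set r := 3 * n%:R * eta; have r0 : 0 < r by rewrite !mulr_gt0.
have e40 : 0 < e / 4 by rewrite divr_gt0.
have [y Yy hy] := pp.2 z _ e40.
pose f w := phi (z + w) - phi z - dot w y.
have f_ge w : - (e / 4) <= f w.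
  by have := pp.1 (z + w) y Yy; rewrite /f dotDl; lra.
have f_axis i s : s = 1 \/ s = -1 -> f (s *: axis r i) <= diff2 (axis r i) z + e / 4.
  have h1 := f_ge (axis r i); have h2 := f_ge (- axis r i).
  rewrite /f /diff2 in h1 h2 *; rewrite dotNl in h2.
  by case=> ->; rewrite ?scale1r ?scaleN1r ?dotNl; lra.
have f_le w : enorm w <= 3 * eta ->
    f w <= n%:R^-1 * \sum_i diff2 (axis r i) z + e / 4.
  move=> hw.
  have hwi i : `|w 0 i| <= 3 * eta by rewrite (le_trans (coord_le_enorm w i)).
  have hs : \sum_i `|w 0 i| <= r.
    rewrite (le_trans (ler_sum _ (fun i _ => hwi i)))// sumr_const card_ord.
    by rewrite -mulr_natl /r le_eqVlt; apply/orP; left; apply/eqP; ring.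
  have h1 := potential_cross_polytope z r0 hs.
  have h2 : dot w y = \sum_i (`|w 0 i| / r) * dot (Num.sg (w 0 i) *: axis r i) y.
    apply: eq_bigr => i _; rewrite dotZl dot_axis {1}(numEsg (w 0 i)).
    by field; rewrite gt_eqF.
  apply: (@le_trans _ _ (\sum_i (`|w 0 i| / r) * f (Num.sg (w 0 i) *: axis r i))).
    rewrite /f -(eq_bigr _ (fun i _ => esym (mulrBr _ _ _))) sumrB -h2; lra.
  apply: (@le_trans _ _ (\sum_i n%:R^-1 * (diff2 (axis r i) z + e / 4))).
    apply: ler_sum => i _; have [->|wi0] := eqVneq (w 0 i) 0.
      rewrite normr0 mul0r mul0r mulr_ge0 ?invr_ge0// addr_ge0 ?diff2_ge0//; exact: ltW.
    apply: (@le_trans _ _ (`|w 0 i| / r * (diff2 (axis r i) z + e / 4))).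
      apply: ler_wpM2l; first by rewrite divr_ge0// ltW.
      apply: f_axis; have [w0|w0] := ltP 0 (w 0 i); first by left; rewrite gtr0_sg.
      by right; rewrite ltr0_sg// lt_neqAle wi0.
    apply: ler_wpM2r; first by rewrite addr_ge0 ?diff2_ge0// ltW.
    rewrite ler_pdivrMr// (le_trans (hwi i))// /r le_eqVlt; apply/orP; left; apply/eqP.
    by field; rewrite gt_eqF.
  rewrite -mulr_sumr big_split/= mulrDr lerD2l sumr_const card_ord.
  by rewrite -[X in _ * X]mulr_natl mulrA mulVf ?mul1r// gt_eqF.
have e1 : x + u = z + (x + u - z) by rewrite [RHS]addrC subrK.
have e2 : x - u = z + (x - u - z) by rewrite [RHS]addrC subrK.
have e3 : x = z + (x - z) by rewrite [RHS]addrC subrK.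
have h1 : f (x + u - z) <= n%:R^-1 * \sum_i diff2 (axis r i) z + e / 4.
  apply: f_le; rewrite addrAC (le_trans (enormD _ _))//; lra.
have h2 : f (x - u - z) <= n%:R^-1 * \sum_i diff2 (axis r i) z + e / 4.
  apply: f_le; rewrite addrAC (le_trans (enormD _ _))// enormN; lra.
have h3 := f_ge (x - z).
rewrite /f -e1 in h1; rewrite /f -e2 in h2; rewrite /f -e3 in h3.
rewrite !(dotBl, dotDl) in h1 h2 h3; rewrite {1}/diff2.
set S := \sum_i _ in h1 h2 *.
rewrite (_ : 2 / n%:R * S = n%:R^-1 * S + n%:R^-1 * S); last by ring.
lra.
Qed.

End SecondDifference.

(** * Averaging second differences over balls *)

Section Averaging.
Context {R : realType}.

Lemma lipschitz_measurable n (f : 'rV[R]_n -> R) (K : R) :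
  (forall x z, f x - f z <= K * enorm (x - z)) -> measurable_fun setT f.
Proof.
move=> hf; apply: rV_continuous_measurable => x.
have FF : Filter (nbhs x) := nbhs_filter x.
apply/cvgrPdist_lt => e e0.
pose K' := `|K| + 1; have K'0 : 0 < K' by rewrite ltr_wpDl.
pose dl := e / (K' * (n%:R + 1)).
have n0 : 0 < n%:R + 1 :> R by rewrite ltr_wpDl.
have dl0 : 0 < dl by rewrite divr_gt0// mulr_gt0.
have hxz z z' : enorm (z - z') <= n%:R * dl -> f z - f z' < e.
  move=> hz; rewrite (le_lt_trans (hf z z'))//.
  apply: (@le_lt_trans _ _ (K' * (n%:R * dl))).
    apply: (@le_trans _ _ (K' * enorm (z - z'))); last by rewrite ler_pM2l.
    rewrite ler_wpM2r ?enorm_ge0//; have := ler_norm K; rewrite /K'; lra.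
  have -> : K' * (n%:R * dl) = e * (n%:R / (n%:R + 1)).
    by rewrite /dl; field; rewrite !gt_eqF.
  by rewrite gtr_pMr// ltr_pdivrMr// mul1r ltrDl.
have hnb : nbhs x (ball x dl) by apply: nbhsx_ballx.
apply: filterS hnb => y hy; have {}hy := (ball_rVP _ _ dl0).1 hy.
have h1 : enorm (x - y) <= n%:R * dl.
  by apply: enorm_le_coord => i; rewrite !mxE; exact: ltW.
by rewrite ltr_norml ltrNl opprB !hxz// enormBC.
Qed.

(** The volume of the boundary layer of width [r], up to the unit volume. *)
Lemma subXX_le (x r : R) n : 0 <= x -> 0 <= r ->
  (x + r) ^+ n - x ^+ n <= n%:R * r * (x + r) ^+ n.-1.
Proof.
move=> x0 r0; elim: n => [|n IH]; first by rewrite !expr0 subrr mul0r mul0r.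
rewrite !exprS; case: n IH => [|n] IH; first by rewrite !expr0 /= !mulr1 mul1r addrC addKr.
have h1 : x ^+ n.+1 <= (x + r) ^+ n.+1 by rewrite lerXn2r ?nnegrE ?addr_ge0// lerDl.
have h2 : 0 <= x + r by rewrite addr_ge0.
have h3 := ler_wpM2l h2 IH; have h4 := ler_wpM2l r0 h1.
move: h3 h4; rewrite /= exprS -[n.+2%:R]natr1.
set a := (x + r) ^+ n; set b := x ^+ n.+1; set m := n.+1%:R.
by rewrite -subr_ge0 => h3 h4; nra.
Qed.

Lemma ge0_integral_translate n (v : 'rV[R]_n) (D : set 'rV[R]_n) (f : 'rV[R]_n -> \bar R) :
  measurable D -> measurable_fun setT f -> (forall x, 0 <= f x)%E ->
  (\int[lebm n]_(z in [set z | D (z + v)%R]) f (z + v)%R = \int[lebm n]_(z in D) f z)%E.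
Proof.
move=> mD mf f0.
have ma : measurable_fun setT (fun z : 'rV[R]_n => z + v).
  by apply: measurable_rVD => //; exact: measurable_cst.
have := @ge0_integral_pushforward _ _ _ _ R _ ma (lebm n) D f mD (measurable_funTS mf) (fun y _ => f0 y).
rewrite /comp => <-; apply: eq_measure_integral => A mA _.
exact: lebm_translate.
Qed.

End Averaging.

Section IntegralSecondDifference.
Context {R : realType} {n : nat}.
Local Notation E := 'rV[R]_n.
Variables (Y : set E) (phi psi : E -> R) (BY DY : R).
Hypothesis hY : forall y, Y y -> enorm y <= BY.
Hypothesis hDY : forall y y', Y y -> Y y' -> enorm (y - y') <= DY.
Hypothesis pp : potential_pair Y phi psi.

Lemma measurable_potential : measurable_fun setT phi.
Proof. exact: lipschitz_measurable (potential_lipschitz hY pp). Qed.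

Lemma measurable_shift (v : E) (f : E -> R) :
  measurable_fun setT f -> measurable_fun setT (fun z : E => f (z + v)).
Proof.
move=> mf; apply: (measurableT_comp mf).
by apply: measurable_rVD => //; exact: measurable_cst.
Qed.

Lemma measurable_diff2 u : measurable_fun setT (diff2 phi u).
Proof.
apply: measurable_funB; last by apply: measurable_funM => //; exact: measurable_potential.
by apply: measurable_funD; apply: measurable_shift; exact: measurable_potential.
Qed.

Lemma measurable_osc2 eta : 0 <= eta -> measurable_fun setT (osc2 phi eta).
Proof.
move=> e0; apply: (@lipschitz_measurable _ _ _ (4 * BY)) => x z.
rewrite lerBlDr; apply: ge_sup; first by have [] := osc2_has_sup hY pp x e0.
move=> _ [u /= hu <-].
have h := diff2_le_osc2 hY pp z hu.
have h1 := potential_lipschitz hY pp (x + u) (z + u).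
have h2 := potential_lipschitz hY pp (x - u) (z - u).
have h3 := potential_lipschitz hY pp z x.
rewrite enormBC in h3.
rewrite opprD addrACA subrr addr0 in h1; rewrite opprD addrACA subrr addr0 in h2.
by rewrite /diff2 in h *; lra.
Qed.

(** The increment of [phi] over a step [axis r i] varies by at most [r * DY],
    so its difference over one more step integrates, after a translation, to
    a contribution of the boundary layer of the ball only. *)
Lemma integral_diff2 (c : E) (s r : R) (i : 'I_n) : 0 < s -> 0 < r ->
  (\int[lebm n]_(z in eball c s) (diff2 phi (axis r i) z)%:E
    <= (r * DY * (((s + r) ^+ n - s ^+ n) * beta n))%:E)%E.
Proof.
move=> s0 r0; set a := axis r i; set O := eball c s.
pose u z := phi (z + a) - phi z.
have hu z z' : u z - u z' <= r * DY.
  apply/ler_addgt0Pr => e e0; have e20 : 0 < e / 2 by rewrite divr_gt0.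
  have [y Yy hy] := pp.2 (z + a) _ e20; have [y' Yy' hy'] := pp.2 z' _ e20.
  have h1 := pp.1 z y Yy; have h2 := pp.1 (z' + a) y' Yy'.
  rewrite dotDl dot_axis in hy; rewrite dotDl dot_axis in h2.
  have h3 : r * (y 0 i - y' 0 i) <= r * DY.
    rewrite ler_pM2l// (le_trans _ (hDY Yy Yy'))//.
    by have := coord_le_enorm (y - y') i; rewrite !mxE; apply: le_trans; exact: ler_norm.
  rewrite /u; lra.
(* shift the increment so that it takes values in [0, r * DY] *)
have u0 : range u !=set0 by exists (u 0), 0.
have lbu : has_lbound (range u).
  by exists (u 0 - r * DY) => _ [z _ <-]; have := hu 0 z; lra.
pose v z := u z - inf (range u).
have v_ge0 z : 0 <= v z by rewrite subr_ge0; apply: ge_inf => //; exists z.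
have v_le z : v z <= r * DY.
  rewrite lerBlDr -lerBlDl; apply: lb_le_inf => // _ [z' _ <-].
  by have := hu z z'; lra.
have mv : measurable_fun setT v.
  apply: measurable_funB; last exact: measurable_cst.
  by apply: measurable_funB; [apply: measurable_shift|]; exact: measurable_potential.
have vE z : v z = diff2 phi a z + v (z - a).
  by rewrite /v /u /diff2 subrK; ring.
have mO : measurable O by exact: eball_measurable.
pose O' : set E := eball (c - a) s.
have mO' : measurable O' by exact: eball_measurable.
have mvE (D : set E) : measurable_fun D (fun z => (v z)%:E).
  by apply: measurable_funTS; exact/measurable_EFinP.
have mvs (D : set E) : measurable_fun D (fun z => (v (z - a))%:E).
  by apply: measurable_funTS; apply/measurable_EFinP; exact: measurable_shift.
have md (D : set E) : measurable_fun D (fun z => (diff2 phi a z)%:E).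
  by apply: measurable_funTS; apply/measurable_EFinP; exact: measurable_diff2.
(* the translated term integrates [v] over the shifted ball [O'], and only
   the part of [O] outside [O'] does not cancel *)
have e1 : (\int[lebm n]_(z in O) (v z)%:E =
    \int[lebm n]_(z in O) (diff2 phi a z)%:E + \int[lebm n]_(z in O') (v z)%:E)%E.
  rewrite -(@ge0_integral_translate _ n (- a) O' (fun z => (v z)%:E)) //.
  rewrite (_ : [set z | _] = O); last first.
    apply/seteqP; split=> z; rewrite /O' /O /eball/=; by rewrite opprB addrA subrK.
  rewrite -ge0_integralD//.
  - by apply: eq_integral => z _; rewrite -EFinD -vE.
  - by move=> z _; rewrite lee_fin (diff2_ge0 pp).
  - by move=> z _; rewrite lee_fin.
have lO' t : 0 < t -> lebm n (eball (c - a) t) = (t ^+ n * beta n)%:E.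
  by move=> t0; rewrite lebm_eball// -betaE.
have lO's : lebm n O' = (s ^+ n * beta n)%:E by exact: lO'.
have fO' : (\int[lebm n]_(z in O') (v z)%:E < +oo)%E.
  apply: (@le_lt_trans _ _ (\int[lebm n]_(z in O') (r * DY)%:E)%E).
    by apply: ge0_le_integral => //= z _; rewrite lee_fin.
  by rewrite integral_cst//= lO's -EFinM ltry.
have e2 : (\int[lebm n]_(z in O) (v z)%:E <=
    \int[lebm n]_(z in O') (v z)%:E + \int[lebm n]_(z in O `\` O') (v z)%:E)%E.
  rewrite -ge0_integral_setU//; last 3 first.
  - exact: measurableD.
  - by move=> z _; rewrite lee_fin.
  - by apply/disj_setPS => z [? []].
  apply: ge0_subset_integral => //; first by apply: measurableU => //; exact: measurableD.
    by move=> z _; rewrite lee_fin.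
  by move=> z Oz; have [|] := pselect (O' z); [left|right].
have e3 : (\int[lebm n]_(z in O `\` O') (v z)%:E <= (r * DY)%:E * (((s + r) ^+ n - s ^+ n) * beta n)%:E)%E.
  have mD : measurable (O `\` O') by exact: measurableD.
  apply: (@le_trans _ _ (\int[lebm n]_(z in O `\` O') (r * DY)%:E)%E).
    by apply: ge0_le_integral => //= z _; rewrite lee_fin.
  have rD0 : 0 <= r * DY by rewrite (le_trans (v_ge0 0)).
  rewrite integral_cst//= lee_wpmul2l ?lee_fin//.
  apply: (@le_trans _ _ (lebm n (eball (c - a) (s + r) `\` O'))).
    apply: le_measure; rewrite ?inE//.
      by apply: measurableD => //; exact: eball_measurable.
    apply: setSD => z; rewrite /O /eball/= => hz.
    rewrite opprB addrCA addrC (le_lt_trans (enormD _ _))// ltr_leD//.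
    by rewrite enorm_axis gtr0_norm.
  rewrite measureD//=; last 2 first.
  - exact: eball_measurable.
  - by rewrite lO' ?addr_gt0// ltry.
  have -> : eball (c - a) (s + r) `&` O' = O'.
    by apply/setIidr => z; rewrite /O' /eball/= => /lt_trans; apply; rewrite ltrDl.
  by rewrite lO's lO' ?addr_gt0// -EFinB mulrBl.
move: e2; rewrite e1 addeC leeD2lE; last first.
  by rewrite ge0_fin_numE//; apply: integral_ge0 => z _; rewrite lee_fin.
by move=> /le_trans; apply; rewrite (le_trans e3)// -EFinM.
Qed.

End IntegralSecondDifference.

(** * Integrals against couplings *)

Lemma probability1_ae {R : realType} d (T : measurableType d) (P : probability T R)
    (A : set T) : measurable A -> P A = 1%E -> {ae P, forall x, A x}.
Proof.
move=> mA A1; exists (~` A); split => //; first exact: measurableC.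
by rewrite probability_setC// A1 subee.
Qed.

Section CouplingIntegrals.
Context {R : realType} d1 d2 (T1 : measurableType d1) (T2 : measurableType d2).
Variables (rho : probability T1 R) (mu : probability T2 R)
  (g : probability (T1 * T2)%type R).
Hypothesis cg : couplings rho mu g.
Local Open Scope ereal_scope.

Lemma integral_coupling_fst (f : T1 -> \bar R) :
  measurable_fun setT f -> (forall x, 0 <= f x) ->
  \int[g]_p f p.1 = \int[rho]_x f x.
Proof.
move=> mf f0.
have := @ge0_integral_pushforward _ _ _ _ R _ (@measurable_fst _ _ T1 T2) g setT f
  measurableT mf (fun y _ => f0 y).
rewrite preimage_setT /comp => <-.
by apply: eq_measure_integral => A mA _; exact: cg.1.
Qed.

Lemma integral_coupling_snd (f : T2 -> \bar R) :
  measurable_fun setT f -> (forall x, 0 <= f x) ->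
  \int[g]_p f p.2 = \int[mu]_x f x.
Proof.
move=> mf f0.
have := @ge0_integral_pushforward _ _ _ _ R _ (@measurable_snd _ _ T1 T2) g setT f
  measurableT mf (fun y _ => f0 y).
rewrite preimage_setT /comp => <-.
by apply: eq_measure_integral => A mA _; exact: cg.2.
Qed.

Lemma ae_coupling_fst (P : T1 -> Prop) :
  {ae rho, forall x, P x} -> {ae g, forall z, P z.1}.
Proof.
move=> [N [mN N0 hN]]; exists (fst @^-1` N); split.
- exact: measurable_preim.
- by have := cg.1 _ mN; rewrite N0.
- by move=> z /= nz; exact: hN.
Qed.

Lemma ae_coupling_snd (P : T2 -> Prop) :
  {ae mu, forall x, P x} -> {ae g, forall z, P z.2}.
Proof.
move=> [N [mN N0 hN]]; exists (snd @^-1` N); split.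
- exact: measurable_preim.
- by have := cg.2 _ mN; rewrite N0.
- by move=> z /= nz; exact: hN.
Qed.

End CouplingIntegrals.

(** * Averaged oscillation of subgradients *)

Section OscillationIntegral.
Context {R : realType} {n : nat}.
Local Notation E := 'rV[R]_n.
Variables (Y : set E) (phi psi : E -> R) (BY DY : R).
Hypothesis hY : forall y, Y y -> enorm y <= BY.
Hypothesis hDY : forall y y', Y y -> Y y' -> enorm (y - y') <= DY.
Hypothesis pp : potential_pair Y phi psi.
Variables (X : set E) (c : E) (DX eta Meta : R).
Variables (rho rhot : probability E R) (sigma : probability (E * E)%type R).
Hypothesis (n0 : (0 < n)%N) (eta0 : 0 < eta) (Meta0 : 0 <= Meta).
Hypothesis (DX0 : 0 <= DX) (DY0 : 0 <= DY).
Hypothesis hX : forall x, X x -> enorm (x - c) <= DX.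
Hypothesis mX : measurable X.
Hypothesis rhotX : rhot X = 1%E.
Hypothesis hball : forall x, (rhot (eball x eta) <= Meta%:E)%E.
Hypothesis csigma : couplings rho rhot sigma.

Let r := 3 * n%:R * eta.
Let s := DX + eta.
Let S z := 2 / n%:R * \sum_i diff2 phi (axis r i) z.

Let N0 : 0 < n%:R :> R. Proof. by rewrite ltr0n. Qed.
Let r0 : 0 < r. Proof. by rewrite !mulr_gt0. Qed.
Let s0 : 0 < s. Proof. by rewrite ltr_wpDl. Qed.

Let S_ge0 z : 0 <= S z.
Proof.
by rewrite mulr_ge0 ?divr_ge0// sumr_ge0// => i _; exact: (diff2_ge0 pp).
Qed.

Let mS : measurable_fun setT S.
Proof.
apply: measurable_funM => //; apply: measurable_sum => i.
exact: (measurable_diff2 hY pp).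
Qed.

Let near_pairs : set (E * E) := [set p | enorm (p.2 - p.1) < eta].

Let m_near_pairs : measurable near_pairs.
Proof.
have m : measurable_fun setT (fun p : E * E => enorm (p.2 - p.1)).
  by apply: measurable_enorm; exact: measurable_rVB.
rewrite (_ : near_pairs = (fun p : E * E => enorm (p.2 - p.1)) @^-1` `]-oo, eta[%classic).
  exact: measurable_preim.
by apply/seteqP; split=> t /=; rewrite in_itv.
Qed.

(** [G x] integrates [S] over the centres within [eta] of [x]; for [x] in [X] the
    ball of radius [s] contains all of them, and its indicator keeps the integral
    over all centres finite. *)
Let K (p : E * E) : \bar R := (S p.2 * \1_(eball c s) p.2 * \1_near_pairs p)%:E.
Let G x := (\int[lebm n]_z K (x, z))%E.

Let ind0 T (A : set T) x : 0 <= \1_A x :> R.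
Proof. by rewrite indicE. Qed.

Let SI_ge0 z : 0 <= S z * \1_(eball c s) z.
Proof. exact: mulr_ge0 (S_ge0 z) (ind0 _ z). Qed.

Let K_ge0 p : (0 <= K p)%E.
Proof. by rewrite lee_fin; apply: mulr_ge0. Qed.

Let mI : measurable_fun setT (\1_(eball c s) : E -> R).
Proof. by apply: measurable_indic; exact: eball_measurable. Qed.

Let mK : measurable_fun setT K.
Proof.
apply/measurable_EFinP; apply: measurable_funM; first apply: measurable_funM.
- exact: (measurableT_comp mS).
- exact: (measurableT_comp mI).
- exact: measurable_indic.
Qed.

Let mG : measurable_fun setT G.
Proof. exact: (measurable_fun_fubini_tonelli_F K mK K_ge0). Qed.

Let G_ge0 x : (0 <= G x)%E.
Proof. exact: integral_ge0. Qed.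

Let bnd := 2 * (r * DY * (((s + r) ^+ n - s ^+ n) * beta n)).

Let integral_S : (\int[lebm n]_(z in eball c s) (S z)%:E <= bnd%:E)%E.
Proof.
have mO := eball_measurable c s.
have md i : measurable_fun (eball c s) (fun z => (diff2 phi (axis r i) z)%:E).
  by apply: measurable_funTS; apply/measurable_EFinP; exact: (measurable_diff2 hY pp).
rewrite (eq_integral (fun z => (2 / n%:R)%:E * \sum_i (diff2 phi (axis r i) z)%:E)%E); last first.
  by move=> z _; rewrite /S EFinM sumEFin.
rewrite ge0_integralZl_EFin//; last 2 first.
- by move=> z _; apply: sume_ge0 => i _; rewrite lee_fin (diff2_ge0 pp).
- exact: emeasurable_sum.
rewrite ge0_integral_sum//; last by move=> i z _; rewrite lee_fin (diff2_ge0 pp).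
apply: (@le_trans _ _ ((2 / n%:R)%:E * \sum_(i < n) (r * DY * (((s + r) ^+ n - s ^+ n) * beta n))%:E)%E).
  rewrite lee_wpmul2l ?lee_fin ?divr_ge0//; apply: lee_sum => i _.
  exact: (integral_diff2 hY hDY pp).
rewrite sumEFin sumr_const card_ord -EFinM lee_fin /bnd -[X in _ * X]mulr_natl mulrA.
by rewrite divfK ?gt_eqF.
Qed.

(** By Fubini, the small-ball bound is applied around each centre [z]. *)
Let integral_G : (\int[rhot]_x G x <= (Meta * bnd)%:E)%E.
Proof.
rewrite (fubini_tonelli K mK K_ge0).
apply: (@le_trans _ _ (\int[lebm n]_z (Meta%:E * (S z * \1_(eball c s) z)%:E))%E).
  apply: ge0_le_integral => //.
  - by move=> z _; apply: integral_ge0.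
  - exact: (measurable_fun_fubini_tonelli_G K mK K_ge0).
  - apply: emeasurable_funM => //; apply/measurable_EFinP.
    exact: measurable_funM.
  move=> z _; rewrite /K /=.
  rewrite (eq_integral (fun x => (S z * \1_(eball c s) z)%:E * (\1_(eball z eta) x)%:E)%E); last first.
    move=> x _; rewrite -EFinM; congr (_ * _)%:E; rewrite !indicE.
    rewrite (_ : ((x, z) \in near_pairs) = (x \in eball z eta))//.
    by apply/idP/idP; rewrite !inE /near_pairs /eball/= enormBC.
  rewrite ge0_integralZl_EFin//; last first.
    by apply/measurable_EFinP; apply: measurable_indic; exact: eball_measurable.
  rewrite integral_indic ?setIT//; last exact: eball_measurable.
  rewrite [leRHS]muleC; apply: lee_wpmul2l; last exact: hball.
  by rewrite lee_fin; exact: SI_ge0.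
rewrite ge0_integralZl_EFin//; last 2 first.
- by move=> z _; rewrite lee_fin; exact: SI_ge0.
- by apply/measurable_EFinP; exact: measurable_funM.
rewrite EFinM lee_wpmul2l ?lee_fin// (le_trans _ integral_S)//.
rewrite [leRHS]integral_mkcond le_eqVlt; apply/orP; left; apply/eqP.
apply: eq_integral => z _; rewrite patchE indicE.
by case: (z \in _); rewrite ?mulr1 ?mulr0.
Qed.

(** Every point within [eta] of [xt] has an oscillation bounded by [S] at each
    centre [z] within [eta] of [xt], hence by the average of [S] over these
    centres. *)
Let osc2_le_G x xt : X xt -> enorm (x - xt) <= eta ->
  ((osc2 phi eta x / eta)%:E <= (eta * (eta ^+ n * beta n))^-1%:E * G xt)%E.
Proof.
move=> Xxt hx; have b0 := @beta_gt0 R n.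
have en0 : 0 < eta ^+ n * beta n by rewrite mulr_gt0// exprn_gt0.
have h : ((osc2 phi eta x)%:E * (eta ^+ n * beta n)%:E <= G xt)%E.
  rewrite EFinM betaE -(lebm_eball xt)//.
  rewrite -(integral_cst (lebm n) (eball_measurable xt eta)) /G integral_mkcond.
  apply: ge0_le_integral => //.
  - move=> z _; rewrite patchE; case: ifP => // _.
    by rewrite lee_fin (osc2_ge0 hY pp)// ltW.
  - by apply: (measurable_restrictT (cst _) (eball_measurable xt eta)).1.
  - apply: (measurableT_comp mK).
    by apply: measurable_fun_pair => //; exact: measurable_cst.
  move=> z _; rewrite patchE; case: ifPn => [|_]; last exact: K_ge0.
  rewrite inE /eball/= => hz; rewrite /K /= !indicE !mem_set ?mulr1; last 2 first.
  - by rewrite /near_pairs.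
  - rewrite /eball/= (le_lt_trans (enorm_dist_triangle z xt c))// addrC.
    by rewrite ler_ltD// hX.
  rewrite lee_fin; apply: (osc2_le_diff2 hY pp) => //.
  rewrite (le_trans (enorm_dist_triangle x xt z))//.
  rewrite (_ : 2 * eta = eta + eta); last by ring.
  by rewrite lerD// enormBC ltW.
set k := eta * _; have k0 : 0 < k by rewrite mulr_gt0.
have -> : osc2 phi eta x / eta = k^-1 * (osc2 phi eta x * (eta ^+ n * beta n)).
  by rewrite /k; field; rewrite !gt_eqF// exprn_gt0.
by rewrite !EFinM lee_wpmul2l// lee_fin invr_ge0 ltW.
Qed.

Let far_pairs : set (E * E) := [set p | eta < enorm (p.1 - p.2)].

Lemma measurable_far_pairs : measurable far_pairs.
Proof.
have m := @measurable_dist R n.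
rewrite (_ : far_pairs = (fun p : E * E => enorm (p.1 - p.2)) @^-1` `]eta, +oo[%classic).
  exact: measurable_preim.
by apply/seteqP; split=> t /=; rewrite in_itv/= andbT.
Qed.

(** The measure [rho] is arbitrary, so [osc2] may be large on all of its mass.
    Along the coupling [sigma] each point is replaced by a point of [rhot]
    within [eta], at the price of the trivial bound [DY] on the remaining
    pairs. *)
Lemma integral_osc2 :
  (\int[rho]_x (Num.min DY (osc2 phi eta x / eta))%:E <=
   DY%:E * sigma far_pairs +
   (Meta * 2 * (r * DY * ((s + r) ^+ n - s ^+ n)) / (eta * eta ^+ n))%:E)%E.
Proof.
have b0 := @beta_gt0 R n.
have mo : measurable_fun setT (fun x : E => Num.min DY (osc2 phi eta x / eta)).
  apply: measurable_minr; first exact: measurable_cst.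
  by apply: measurable_funM => //; apply: (measurable_osc2 hY pp); exact: ltW.
have o0 x : 0 <= Num.min DY (osc2 phi eta x / eta).
  by rewrite le_min DY0 divr_ge0 ?(osc2_ge0 hY pp) ?ltW.
have mo' : measurable_fun setT (fun x : E => (Num.min DY (osc2 phi eta x / eta))%:E).
  exact/measurable_EFinP.
rewrite -(integral_coupling_fst csigma mo'); last by move=> x; rewrite lee_fin.
set k := (eta * (eta ^+ n * beta n))^-1.
have k0 : 0 <= k by rewrite invr_ge0 !mulr_ge0// ?exprn_ge0// ltW.
have m_ind : measurable_fun setT (fun p => (\1_far_pairs p)%:E : \bar R).
  by apply/measurable_EFinP; apply: measurable_indic; exact: measurable_far_pairs.
have m_far : measurable_fun setT (fun p => DY%:E * (\1_far_pairs p)%:E)%E.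
  by apply: emeasurable_funM; first exact: measurable_cst.
have mG2 : measurable_fun setT (fun p : E * E => G p.2).
  exact: (measurableT_comp mG measurable_snd).
have m_near : measurable_fun setT (fun p : E * E => k%:E * G p.2)%E.
  by apply: emeasurable_funM; first exact: measurable_cst.
apply: (@le_trans _ _ (\int[sigma]_p (DY%:E * (\1_far_pairs p)%:E + k%:E * G p.2))%E).
  apply: ae_ge0_le_integral => //.
  - by move=> p _; rewrite lee_fin.
  - exact: (measurableT_comp mo').
  - by move=> p _; rewrite adde_ge0// mule_ge0// lee_fin.
  - by apply: emeasurable_funD.
  have := ae_coupling_snd csigma (probability1_ae mX rhotX).
  apply: filterS => p Xp _.
  have [far|near] := boolP (p \in far_pairs).
    rewrite indicE far mule1 (@le_trans _ _ DY%:E)//; first by rewrite lee_fin ge_min lexx.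
    by rewrite leeDl// mule_ge0// lee_fin.
  rewrite indicE (negbTE near) mule0 add0e.
  have hp : enorm (p.1 - p.2) <= eta.
    by rewrite leNgt; apply: contra near => h; rewrite inE.
  by rewrite (le_trans _ (osc2_le_G Xp hp))// lee_fin ge_min lexx orbT.
rewrite ge0_integralD//; last 2 first.
- by move=> p _; rewrite mule_ge0// lee_fin.
- by move=> p _; rewrite mule_ge0// lee_fin.
rewrite ge0_integralZl_EFin//.
rewrite integral_indic ?setIT//; last exact: measurable_far_pairs.
rewrite ge0_integralZl_EFin//.
rewrite leeD2l// (integral_coupling_snd csigma mG G_ge0).
apply: (@le_trans _ _ (k%:E * (Meta * bnd)%:E)%E); first by rewrite lee_wpmul2l ?lee_fin.
rewrite -EFinM lee_fin /k /bnd le_eqVlt; apply/orP; left; apply/eqP; field.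
by rewrite !gt_eqF// exprn_gt0.
Qed.

End OscillationIntegral.

(** * Optimal plans are cyclically monotone *)

Lemma probability_of_measure {R : realType} d (T : measurableType d)
    (m : {measure set T -> \bar R}) : m setT = 1%E ->
  exists P : probability T R, P = m :> (set T -> \bar R).
Proof.
move=> m1.
have mE : mrestr m measurableT = m by apply/funext => A; rewrite /mrestr setIT.
have m1' : mrestr m measurableT setT = 1%E by rewrite mE.
pose mix := Measure_isProbability.Build _ _ _ (mrestr m measurableT) m1'.
pose P : probability T R := HB.pack (mrestr m measurableT) mix.
by exists P.
Qed.

Section Exchange.
Context {R : realType} d1 d2 (T1 : measurableType d1) (T2 : measurableType d2).
Local Open Scope ereal_scope.
Variables (rho : probability T1 R) (mu : probability T2 R)
  (g : probability (T1 * T2)%type R) (c : T1 * T2 -> \bar R).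
Hypothesis cg : couplings rho mu g.
Hypothesis c0 : forall p, 0 <= c p.
Hypothesis mc : measurable_fun setT c.
Hypothesis copt : forall g', couplings rho mu g' ->
  \int[g]_p c p <= \int[g']_p c p.
Hypothesis cfin : \int[g]_p c p < +oo.

(** Putting [a'] in the place of the part [a] of the plan gives a competitor
    for the plan. *)
Lemma optimal_exchange (rest a a' : {measure set (T1 * T2)%type -> \bar R}) :
  (forall A, measurable A -> g A = rest A + a A) ->
  (forall A, measurable A -> a (fst @^-1` A) = a' (fst @^-1` A)) ->
  (forall B, measurable B -> a (snd @^-1` B) = a' (snd @^-1` B)) ->
  \int[a]_p c p <= \int[a']_p c p.
Proof.
move=> gE a1 a2.
pose m' : {measure set (T1 * T2)%type -> \bar R} := measure_add rest a'.
have m'E A : m' A = rest A + a' A by exact: measure_addE.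
have m'1 : m' setT = 1.
  rewrite m'E -(preimage_setT (@fst T1 T2)) -a1// -gE; last by rewrite preimage_setT.
  by rewrite preimage_setT probability_setT.
have [g' g'E] := probability_of_measure m'1.
have cg' : couplings rho mu g'.
  split=> A mA; rewrite /pushforward g'E m'E.
    rewrite -a1// -gE; first exact: cg.1.
    exact: measurable_preim.
  rewrite -a2// -gE; first exact: cg.2.
  exact: measurable_preim.
have h := copt cg'.
have e1 : \int[g]_p c p = \int[rest]_p c p + \int[a]_p c p.
  rewrite -ge0_integral_measure_add//.
  apply: eq_measure_integral => A mA _.
  exact: (etrans (gE A mA) (esym (measure_addE _ _ _))).
have e2 : \int[g']_p c p = \int[rest]_p c p + \int[a']_p c p.
  rewrite -ge0_integral_measure_add//.
  apply: eq_measure_integral => A mA _.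
  exact: (congr1 (fun f => f A) g'E).
move: h; rewrite e1 e2 leeD2lE//.
rewrite ge0_fin_numE ?integral_ge0//; apply: le_lt_trans cfin; rewrite e1 leeDl//.
exact: integral_ge0.
Qed.

End Exchange.

Section Mixed.
Context {R : realType} d1 d2 (T1 : measurableType d1) (T2 : measurableType d2).
Local Open Scope ereal_scope.
Local Notation T := (T1 * T2)%type.
Implicit Types m : {finite_measure set T -> \bar R}.

Let mix (z : T * T) : T := (z.1.1, z.2.2).

Let measurable_mix : measurable_fun setT mix.
Proof.
apply: measurable_fun_pair.
  exact: (measurableT_comp measurable_fst).
exact: (measurableT_comp measurable_snd).
Qed.

(** The product of the first marginal of [m] and the second marginal of
    [m']. *)
Definition mixed m m' : {measure set T -> \bar R} :=
  pushm (m \x m')%E measurable_mix.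

Lemma mixed_fst m m' A : measurable A ->
  mixed m m' (fst @^-1` A) = m (fst @^-1` A) * m' setT.
Proof.
move=> mA; rewrite /mixed pushmE /pushforward -product_measure1E//; last exact: measurable_preim.
by congr ((m \x m') _); apply/seteqP; split=> z /=; [move=> h; split|case].
Qed.

Lemma mixed_snd m m' A : measurable A ->
  mixed m m' (snd @^-1` A) = m setT * m' (snd @^-1` A).
Proof.
move=> mA; rewrite /mixed pushmE /pushforward -product_measure1E//; last exact: measurable_preim.
by congr ((m \x m') _); apply/seteqP; split=> z /=; [move=> h; split|case].
Qed.

End Mixed.

Section ExchangeCycle.
Context {R : realType} d1 d2 (T1 : measurableType d1) (T2 : measurableType d2).
Local Open Scope ereal_scope.
Variables (rho : probability T1 R) (mu : probability T2 R)
  (g : probability (T1 * T2)%type R) (c : T1 * T2 -> \bar R).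
Hypothesis cg : couplings rho mu g.
Hypothesis c0 : forall p, 0 <= c p.
Hypothesis mc : measurable_fun setT c.
Hypothesis copt : forall g', couplings rho mu g' ->
  \int[g]_p c p <= \int[g']_p c p.
Hypothesis cfin : \int[g]_p c p < +oo.
Variables (N : nat) (U : nat -> set T1) (V : nat -> set T2) (m lo hi : nat -> R).
Hypothesis mU : forall k, measurable (U k).
Hypothesis mV : forall k, measurable (V k).
Hypothesis m_gt0 : forall k, (0 < m k)%R.
Hypothesis gUV : forall k, g (U k `*` V k) = (m k)%:E.
Hypothesis lo0 : forall k, (0 <= lo k)%R.
Hypothesis lo_le : forall k z, (U k `*` V k) z -> (lo k)%:E <= c z.

Definition cyclic_pred k : nat := if k is k'.+1 then k' else N.

Hypothesis hi_ge : forall k x y, U (cyclic_pred k) x -> V k y -> c (x, y) <= (hi k)%:E.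

Let A k := U k `*` V k.
Let mA k : measurable (A k). Proof. exact: measurableX. Qed.
Let gm k : {finite_measure set (T1 * T2)%type -> \bar R} := mrestr g (mA k).

Let gmE k B : gm k B = g (B `&` A k). Proof. by []. Qed.
Let gmT k : gm k setT = (m k)%:E. Proof. by rewrite gmE setTI gUV. Qed.

Let m_le1 k : (m k <= 1)%R.
Proof. by rewrite -lee_fin -gUV probability_le1//; exact: measurableX. Qed.

Let t : R := (\prod_(k < N.+1) m k / N.+1%:R)%R.
Let t_gt0 : (0 < t)%R.
Proof. by rewrite divr_gt0// prodr_gt0. Qed.

Let t_le k : (k < N.+1)%N -> (t / m k <= N.+1%:R^-1)%R.
Proof.
move=> kN; rewrite ler_pdivrMr// mulrC /t ler_pM2r ?invr_gt0//.
rewrite (bigD1 (Ordinal kN))//= -[leRHS]mulr1 ler_pM2l//.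
by apply: prodr_ile1 => i _; rewrite m_le1 ltW.
Qed.

Let a k : {nonneg R} := NngNum (divr_ge0 (ltW t_gt0) (ltW (m_gt0 k))).
Let a' k : {nonneg R} :=
  NngNum (divr_ge0 (divr_ge0 (ltW t_gt0) (ltW (m_gt0 k))) (ltW (m_gt0 (cyclic_pred k)))).
Let w : {nonneg R} := NngNum (divr_ge0 (@ler01 R) (ler0n R N.+1)).
Let b_ge0 k : (0 <= Num.max 0 (N.+1%:R^-1 - t / m k))%R.
Proof. by rewrite le_max lexx. Qed.
Let b k : {nonneg R} := NngNum (b_ge0 k).

Let alpha : {measure set (T1 * T2)%type -> \bar R} :=
  msum (fun k => [the {measure set (T1 * T2)%type -> \bar R} of mscale (a k) (gm k)]) N.+1.
Let alpha' : {measure set (T1 * T2)%type -> \bar R} :=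
  msum (fun k => [the {measure set (T1 * T2)%type -> \bar R} of
    mscale (a' k) (mixed (gm (cyclic_pred k)) (gm k))]) N.+1.
Let restk k : {measure set (T1 * T2)%type -> \bar R} :=
  measure_add (mscale w (mrestr g (measurableC (mA k)))) (mscale (b k) (gm k)).
Let rest : {measure set (T1 * T2)%type -> \bar R} := msum restk N.+1.

Let alphaE B : alpha B = \sum_(k < N.+1) (t / m k)%:E * g (B `&` A k).
Proof. by []. Qed.

Let alpha'E B : alpha' B =
  \sum_(k < N.+1) (t / m k / m (cyclic_pred k))%:E * mixed (gm (cyclic_pred k)) (gm k) B.
Proof. by []. Qed.

Let restE B : rest B = \sum_(k < N.+1) ((1 / N.+1%:R)%:E * g (B `&` ~` A k)
  + (Num.max 0 (N.+1%:R^-1 - t / m k))%:E * g (B `&` A k)).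
Proof. by apply: eq_bigr => k _; exact: measure_addE. Qed.

Let sum_cyclic_pred (F : nat -> \bar R) :
  \sum_(k < N.+1) F (cyclic_pred k) = \sum_(k < N.+1) F k.
Proof. by rewrite big_ord_recl big_ord_recr/= addeC. Qed.

Let g_split B : measurable B -> g B = rest B + alpha B.
Proof.
move=> mB; rewrite restE alphaE -big_split/=.
transitivity (\sum_(k < N.+1) (N.+1%:R^-1)%:E * g B).
  have -> : g B = (fine (g B))%:E by rewrite fineK// fin_num_measure.
  rewrite -EFinM sumEFin sumr_const card_ord -[X in _ = (X)%:E]mulr_natl mulrA.
  by rewrite mulfV ?mul1r.
apply: eq_bigr => k _.
have tk := t_le (ltn_ord k).
rewrite max_r ?subr_ge0// div1r.
rewrite (measureDI g mB (mA k)) setDE.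
rewrite -[X in _ = X]addeA -ge0_muleDl//; first last.
- by rewrite lee_fin divr_ge0// ltW.
- by rewrite lee_fin subr_ge0.
by rewrite -EFinD subrK ge0_muleDr// addeC.
Qed.

Let alpha_fst B : measurable B -> alpha (fst @^-1` B) = alpha' (fst @^-1` B).
Proof.
move=> mB; rewrite alphaE alpha'E.
rewrite -(sum_cyclic_pred (fun k => (t / m k)%:E * g ((fst @^-1` B) `&` A k))).
apply: eq_bigr => k _; rewrite mixed_fst// gmT gmE [g _ * _]muleC muleA -EFinM.
by congr ((_)%:E * _); field; rewrite !gt_eqF.
Qed.

Let alpha_snd B : measurable B -> alpha (snd @^-1` B) = alpha' (snd @^-1` B).
Proof.
move=> mB; rewrite alphaE alpha'E.
apply: eq_bigr => k _; rewrite mixed_snd// gmT gmE muleA -EFinM.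
by congr ((_)%:E * _); field; rewrite !gt_eqF.
Qed.

Let int_gm k : (lo k * m k)%:E <= \int[gm k]_p c p.
Proof.
apply: (@le_trans _ _ (\int[gm k]_(p in A k) c p)); last first.
  by apply: ge0_subset_integral.
apply: (@le_trans _ _ (\int[gm k]_(p in A k) (lo k)%:E)).
  by rewrite integral_cst//= gmE setIid gUV EFinM.
apply: ge0_le_integral => //.
- by move=> p _; rewrite lee_fin.
- exact: measurable_funTS.
- by move=> p; exact: lo_le.
Qed.

Let hi0 k : (0 <= hi k)%R.
Proof.
have ne j : A j !=set0.
  apply/set0P/eqP => A0; have := gUV j; rewrite -/(A j) A0 measure0 => -[m0].
  by have := m_gt0 j; rewrite -m0 ltxx.
have [[x y] [Ux _]] := ne (cyclic_pred k); have [[x' y'] [_ Vy']] := ne k.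
by rewrite -lee_fin (le_trans _ (hi_ge Ux Vy')).
Qed.

Let int_mixed k :
  \int[mixed (gm (cyclic_pred k)) (gm k)]_p c p <= (hi k * (m (cyclic_pred k) * m k))%:E.
Proof.
set mm := mixed _ _.
have mmT : mm setT = (m (cyclic_pred k) * m k)%:E.
  by rewrite -(preimage_setT (@fst T1 T2)) /mm mixed_fst// preimage_setT !gmT EFinM.
apply: (@le_trans _ _ (\int[mm]_p (hi k)%:E)); last by rewrite integral_cst//= mmT EFinM.
apply: ae_ge0_le_integral => //; first by move=> p _; rewrite lee_fin.
have n1 : mm (fst @^-1` (~` U (cyclic_pred k))) = 0.
  rewrite /mm mixed_fst ?gmE; last exact: measurableC.
  rewrite (_ : _ `&` _ = set0) ?measure0 ?mul0e//.
  by apply/seteqP; split=> // z [/= h [] /h].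
have n2 : mm (snd @^-1` (~` V k)) = 0.
  rewrite /mm mixed_snd ?gmE; last exact: measurableC.
  rewrite [X in _ * g X](_ : _ `&` _ = set0) ?measure0 ?mule0//.
  by apply/seteqP; split=> // z [/= h [] _ /h].
have N1 : mm.-negligible (fst @^-1` (~` U (cyclic_pred k))).
  by apply/negligibleP => //; apply: measurable_preim => //; exact: measurableC.
have N2 : mm.-negligible (snd @^-1` (~` V k)).
  by apply/negligibleP => //; apply: measurable_preim => //; exact: measurableC.
apply: negligibleS (negligibleU N1 N2).
move=> [x y] /= h; apply: contrapT => /not_orP[/contrapT Ux /contrapT Vy].
by apply: h => _; exact: hi_ge.
Qed.

(** Take the same mass [t] out of each rectangle [U k `*` V k] and put it back
    so that the sources of [U (cyclic_pred k)] are sent to the targets of [V k]. The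
    weights [t / m k] equalise the masses of the pieces, and the factor
    [1 / N.+1] keeps what is left nonnegative even if rectangles overlap or
    coincide. *)
Lemma exchange_cycle : (\sum_(k < N.+1) lo k <= \sum_(k < N.+1) hi k)%R.
Proof.
have := optimal_exchange cg c0 mc copt cfin g_split alpha_fst alpha_snd.
rewrite /alpha /alpha' !ge0_integral_measure_sum//= => h.
have {}h : \sum_(k < N.+1) (t * lo k)%:E <= \sum_(k < N.+1) (t * hi k)%:E.
  apply: (le_trans _ (le_trans h _)); apply: lee_sum => k _.
    rewrite ge0_integral_mscale//=.
    apply: (@le_trans _ _ ((t / m k)%:E * (lo k * m k)%:E)).
      by rewrite -EFinM lee_fin le_eqVlt; apply/orP; left; apply/eqP; field; rewrite gt_eqF.
    apply: lee_wpmul2l (int_gm k); rewrite lee_fin.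
    exact: divr_ge0 (ltW t_gt0) (ltW (m_gt0 k)).
  rewrite ge0_integral_mscale//=.
  apply: (@le_trans _ _ ((t / m k / m (cyclic_pred k))%:E * (hi k * (m (cyclic_pred k) * m k))%:E)).
    apply: lee_wpmul2l (int_mixed k); rewrite lee_fin.
    exact: divr_ge0 (divr_ge0 (ltW t_gt0) (ltW (m_gt0 k))) (ltW (m_gt0 _)).
  by rewrite -EFinM lee_fin le_eqVlt; apply/orP; left; apply/eqP; field; rewrite !gt_eqF.
by move: h; rewrite !sumEFin lee_fin -!mulr_sumr ler_pM2l.
Qed.

End ExchangeCycle.

Section PlanSupport.
Context {R : realType} {n : nat}.
Local Notation E := 'rV[R]_n.
Variables (X Y : set E) (rho mu : probability E R) (g : probability (E * E)%type R).
Variable (B : R).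
Hypothesis mX : measurable X.
Hypothesis mY : measurable Y.
Hypothesis rhoX : rho X = 1%E.
Hypothesis muY : mu Y = 1%E.
Hypothesis hX : forall x, X x -> enorm x <= B.
Hypothesis hY : forall y, Y y -> enorm y <= B.

Definition box (p : E * E) (dl : R) : set (E * E) := ball p.1 dl `*` ball p.2 dl.

(** The topological support, cut down to the product of the domains. *)
Definition plan_support : set (E * E) :=
  [set p | [/\ X p.1, Y p.2 & forall dl, 0 < dl -> g (box p dl) != 0%E]].

Lemma ball_measurable (x : E) (e : R) : 0 < e -> measurable (ball x e).
Proof.
move=> e0; apply: (@ball_measurable_preim _ _ _ E id) => // i.
exact: measurable_coord.
Qed.

Lemma box_measurable p dl : 0 < dl -> measurable (box p dl).
Proof. by move=> d0; apply: measurableX; exact: ball_measurable. Qed.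

(** The complement is covered by the null boxes with rational centres and
    radii, of which there are countably many. *)
Lemma plan_support_ae : couplings rho mu g -> {ae g, forall p, plan_support p}.
Proof.
move=> cg.
have hx := ae_coupling_fst cg (probability1_ae mX rhoX); have hy := ae_coupling_snd cg (probability1_ae mY muY).
pose Q (j : 'rV[rat]_n * 'rV[rat]_n * nat) : set (E * E) :=
  box (ratv j.1.1, ratv j.1.2) j.2.+1%:R^-1.
have Q_meas j : measurable (Q j) by apply: box_measurable; rewrite invr_gt0.
pose F (i : nat) : set (E * E) :=
  if unpickle i is Some j then (if g (Q j) == 0%E then Q j else set0) else set0.
have hF : {ae g, forall p, ~ (\bigcup_i F i) p}.
  suff h : g.-negligible (\bigcup_i F i).
    by apply: negligibleS h => p /= /contrapT.
  apply: negligible_bigcup => i; rewrite /F; case: unpickle => [j|]; last exact: negligible_set0.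
  by case: eqP => [Q0|_]; [apply/negligibleP|exact: negligible_set0].
move: hx hy hF; apply: filterS3 => p Xp Yp nF; split=> // dl d0; apply/eqP => p0; apply: nF.
have [k] := ltr_add_invr (divr_gt0 d0 (ltr0n R 2)); rewrite add0r => hk.
have k0 : 0 < k.+1%:R^-1 :> R by rewrite invr_gt0.
have [q1 hq1] := ratv_dense p.1 k0; have [q2 hq2] := ratv_dense p.2 k0.
have Qsub : Q (q1, q2, k) `<=` box p dl.
  move=> z [h1 h2]; split.
    apply: (@le_ball _ _ _ (k.+1%:R^-1 + k.+1%:R^-1)); last exact: ball_triangle hq1 h1.
    by rewrite (splitr dl) lerD// ltW.
  apply: (@le_ball _ _ _ (k.+1%:R^-1 + k.+1%:R^-1)); last exact: ball_triangle hq2 h2.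
  by rewrite (splitr dl) lerD// ltW.
have Q0 : g (Q (q1, q2, k)) = 0%E.
  apply/eqP; rewrite -measure_le0 -p0 le_measure ?inE//; exact: box_measurable.
exists (pickle (q1, q2, k)); first exact: I.
rewrite /F pickleK Q0 eqxx.
by split; exact: ball_sym.
Qed.

Lemma measurable_sqdist :
  measurable_fun setT (fun p : E * E => (enorm (p.1 - p.2) ^+ 2)%:E : \bar R).
Proof.
by apply/measurable_EFinP; apply: measurable_funX; exact: measurable_dist.
Qed.

Lemma dist_le x y : X x -> Y y -> enorm (x - y) <= 2 * B.
Proof.
move=> Xx Yy; rewrite (le_trans (enormD _ _))// enormN.
by have := hX Xx; have := hY Yy; lra.
Qed.

Lemma quad_cost_fin : couplings rho mu g -> (quad_cost g < +oo)%E.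
Proof.
move=> cg; apply: (@le_lt_trans _ _ (\int[g]_p ((2 * B) ^+ 2)%:E)%E).
  apply: ae_ge0_le_integral => //.
  - by move=> p _; rewrite lee_fin sqr_ge0.
  - exact: measurable_sqdist.
  - by move=> p _; rewrite lee_fin sqr_ge0.
  have := plan_support_ae cg; apply: filterS => p [Xp Yp _] _.
  by rewrite lee_fin lerXn2r ?nnegrE ?enorm_ge0 ?dist_le// (le_trans (enorm_ge0 _) (dist_le Xp Yp)).
by rewrite integral_cst//= probability_setT mule1 ltry.
Qed.

Lemma chainE (d : E * E) (x : E) (p : E * E) (s : seq (E * E)) : chain x p s =
  \sum_(k < (size s).+1) dot ((if nat_of_ord k is k'.+1 then (nth d (p :: s) k').1 else x)
     - (nth d (p :: s) k).1) (nth d (p :: s) k).2.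
Proof.
elim: s x p => [|q s IH] x p /=; rewrite big_ord_recl /=; first by rewrite big_ord0.
congr (_ + _); rewrite (IH p.1 q); apply: eq_bigr => -[[|k] hk] _ //=.
Qed.

Lemma sqr_dist_near (D s h om : R) : 0 <= s -> 0 <= D <= 2 * B -> 0 <= h <= 1 ->
  h * (4 * B + 1) <= om -> `|s - D| <= h -> D ^+ 2 - om <= s ^+ 2 <= D ^+ 2 + om.
Proof.
move=> s0 /andP[D0 DB] /andP[h0 h1] hom; rewrite ler_norml => /andP[l1 l2].
apply/andP; split; nra.
Qed.

(** Small boxes around the points of the cycle have positive mass and nearly
    constant cost, so exchanging them as in [exchange_cycle] gives the
    inequality between sums of squared distances; expanding the squares, the
    terms in a single point cancel around the cycle. *)
Theorem optimal_plan_cyclically_monotone :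
  optimal_plans rho mu g -> cyclically_monotone plan_support.
Proof.
move=> [cg copt] p s Sp Ss.
pose N := size s; pose P k := nth p (p :: s) k.
have SP k : plan_support (P k).
  have : P k \in p :: s.
    have [kN|kN] := ltnP k N.+1; first by rewrite mem_nth.
    by rewrite /P nth_default// mem_head.
  by rewrite inE => /orP[/eqP ->//|]; exact: Ss.
have PN : P N = last p s by rewrite /P -[N]/((size (p :: s)).-1) nth_last.
pose C k := enorm ((P k).1 - (P k).2) ^+ 2.
pose C' k := enorm ((P (cyclic_pred N k)).1 - (P k).2) ^+ 2.
have B0 : 0 <= B by have [Xp _ _] := Sp; rewrite (le_trans (enorm_ge0 p.1))// hX.
have key : \sum_(k < N.+1) C k <= \sum_(k < N.+1) C' k.
  apply/ler_addgt0Pr => e e0.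
  pose om := e / (2 * N.+1%:R); have om0 : 0 < om by rewrite divr_gt0// mulr_gt0.
  pose h := Num.min 1 (om / (4 * B + 1)).
  have B41 : 0 < 4 * B + 1 by rewrite ltr_wpDl// mulr_ge0.
  have h0 : 0 < h by rewrite lt_min ltr01 divr_gt0.
  have h01 : 0 <= h <= 1 by rewrite ltW//= ge_min lexx.
  have hom : h * (4 * B + 1) <= om by rewrite -ler_pdivlMr// ge_min lexx orbT.
  pose dl := h / (2 * (n%:R + 1)).
  have n1 : 0 < n%:R + 1 :> R by rewrite ltr_wpDl.
  have dl0 : 0 < dl by rewrite divr_gt0// mulr_gt0.
  have near (x x0 : E) : ball x0 dl x -> enorm (x - x0) <= h / 2.
    move=> /(ball_rVP _ _ dl0) hx.
    have hx' i : `|(x - x0) 0 i| <= dl by rewrite !mxE distrC ltW.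
    rewrite (le_trans (enorm_le_coord hx'))//.
    have -> : n%:R * dl = h / 2 * (n%:R / (n%:R + 1)) by rewrite /dl; field; rewrite gt_eqF.
    have h20 : 0 < h / 2 by rewrite divr_gt0.
    by rewrite ger_pMr// ler_pdivrMr// mul1r lerDl.
  have near2 (x x0 y y0 : E) : ball x0 dl x -> ball y0 dl y -> X x0 -> Y y0 ->
      enorm (x0 - y0) ^+ 2 - om <= enorm (x - y) ^+ 2 <= enorm (x0 - y0) ^+ 2 + om.
    move=> /near hx /near hy Xx0 Yy0; apply: (@sqr_dist_near _ _ h) => //; rewrite ?enorm_ge0 ?dist_le//.
    rewrite ler_norml; apply/andP; split.
      have := enorm_dist_triangle x0 x y0; have := enorm_dist_triangle x y y0.
      rewrite (enormBC x0 x); lra.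
    have := enorm_dist_triangle x x0 y; have := enorm_dist_triangle x0 y0 y.
    rewrite (enormBC y0 y); lra.
  have g_box k : g (box (P k) dl) = (fine (g (box (P k) dl)))%:E.
    by rewrite fineK// fin_num_measure//; exact: box_measurable.
  have m0 k : 0 < fine (g (box (P k) dl)).
    rewrite -lte_fin -g_box lt0e measure_ge0 andbT.
    by have [_ _] := SP k; exact.
  have := @exchange_cycle R _ _ E E rho mu g
    (fun p : E * E => (enorm (p.1 - p.2) ^+ 2)%:E) cg (fun p => sqr_ge0 _)
    measurable_sqdist copt (quad_cost_fin cg) N
    (fun k => ball (P k).1 dl) (fun k => ball (P k).2 dl)
    (fun k => fine (g (box (P k) dl)))
    (fun k => Num.max 0 (C k - om)) (fun k => C' k + om)
    (fun k => ball_measurable _ dl0) (fun k => ball_measurable _ dl0) m0 g_box.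
  have h1 k : 0 <= Num.max 0 (C k - om) by rewrite le_max lexx.
  have h2 k z : (ball (P k).1 dl `*` ball (P k).2 dl) z ->
      ((Num.max 0 (C k - om))%:E <= (enorm (z.1 - z.2) ^+ 2)%:E)%E.
    move=> [z1 z2]; rewrite lee_fin ge_max sqr_ge0/=.
    by have [X1 Y1 _] := SP k; have /andP[] := near2 _ _ _ _ z1 z2 X1 Y1.
  have h3 k x y : ball (P (cyclic_pred N k)).1 dl x -> ball (P k).2 dl y ->
      ((enorm (x - y) ^+ 2)%:E <= (C' k + om)%:E)%E.
    move=> z1 z2; rewrite lee_fin.
    have [X1 _ _] := SP (cyclic_pred N k); have [_ Y1 _] := SP k.
    by have /andP[] := near2 _ _ _ _ z1 z2 X1 Y1.
  move=> /(_ h1 h2 h3) hs.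
  have h4 : \sum_(k < N.+1) (C k - om) <= \sum_(k < N.+1) (C' k + om).
    by apply: le_trans hs; apply: ler_sum => k _; rewrite le_max lexx orbT.
  move: h4; rewrite sumrB big_split/= sumr_const card_ord.
  rewrite lerBlDr -addrA -mulr2n -mulrnA -[om *+ _]mulr_natr.
  rewrite (_ : om * (N.+1 * 2)%:R = e)//.
  by rewrite natrM /om; field; rewrite gt_eqF.
have dE k : dot ((P (cyclic_pred N k)).1 - (P k).1) (P k).2 =
    2^-1 * (dot (P (cyclic_pred N k)).1 (P (cyclic_pred N k)).1 - dot (P k).1 (P k).1 + (C k - C' k)).
  by rewrite /C /C' !sqr_enorm !(dotBl, dotBr) !(dotC (P k).2); field.
have -> : chain (last p s).1 p s =
    \sum_(k < N.+1) dot ((P (cyclic_pred N k)).1 - (P k).1) (P k).2.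
  by rewrite (chainE p); apply: eq_bigr; case=> -[|k] hk _ //=; rewrite -PN.
rewrite (eq_bigr _ (fun (k : 'I_N.+1) _ => dE k)) -mulr_sumr big_split/= !sumrB.
rewrite (_ : \sum_(k < N.+1) dot (P (cyclic_pred N k)).1 (P (cyclic_pred N k)).1 =
  \sum_(k < N.+1) dot (P k).1 (P k).1); last first.
  by rewrite big_ord_recl big_ord_recr/= addrC.
by rewrite subrr add0r pmulr_rle0// subr_le0.
Qed.

End PlanSupport.

(** * Gluing two plans along their first marginal *)

Section Gluing.
Context {R : realType} d1 d2 (T1 : measurableType d1) (T2 : measurableType d2).
Local Open Scope ereal_scope.
Local Notation T := (T1 * T2)%type.
Variables (rho : probability T1 R) (mu : probability T2 R) (g0 g1 : probability T R).
Hypothesis cg0 : couplings rho mu g0.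
Hypothesis cg1 : couplings rho mu g1.
Variable A : nat -> set T1.
Hypothesis mA : forall i, measurable (A i).
Hypothesis tA : trivIset setT A.
Hypothesis UA : \bigcup_i A i = setT.

Let F i : set T := fst @^-1` A i.
Let mF i : measurable (F i). Proof. by apply: measurable_preim. Qed.

Let h0 i : {finite_measure set T -> \bar R} := mrestr g0 (mF i).
Let h1 i : {finite_measure set T -> \bar R} := mrestr g1 (mF i).
Let r i : R := fine (rho (A i)).
Let rE i : rho (A i) = (r i)%:E. Proof. by rewrite fineK// fin_num_measure. Qed.
Let r_ge0 i : (0 <= (r i)^-1)%R. Proof. by rewrite invr_ge0 fine_ge0. Qed.
Let s i : {nonneg R} := NngNum (r_ge0 i).

Let h0E i B : h0 i B = g0 (B `&` F i). Proof. by []. Qed.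
Let h1E i B : h1 i B = g1 (B `&` F i). Proof. by []. Qed.
Let h0T i : h0 i setT = (r i)%:E.
Proof. by rewrite h0E setTI -rE; exact: cg0.1. Qed.
Let h1T i : h1 i setT = (r i)%:E.
Proof. by rewrite h1E setTI -rE; exact: cg1.1. Qed.

Let glue_meas : {measure set (T * T)%type -> \bar R} :=
  mseries (fun i => [the {measure set (T * T)%type -> \bar R} of mscale (s i) (h0 i \x h1 i)]) 0.

Let glueE B : glue_meas B = \sum_(0 <= i <oo) (r i)^-1%:E * (h0 i \x h1 i) B.
Proof. by []. Qed.

Let sum_cells (g : probability T R) B : measurable B ->
  \sum_(0 <= i <oo) g (B `&` F i) = g B.
Proof.
move=> mB; rewrite -[in RHS](setIT B).
have -> : setT = \bigcup_i F i by rewrite -preimage_bigcup UA preimage_setT.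
rewrite setI_bigcupr measure_semi_bigcup//.
- by move=> i; exact: measurableI.
- have /trivIsetP tA' := tA; apply/trivIsetP => i j _ _ ij.
  apply/seteqP; split=> // z [[_ zi] [_ zj]].
  have : (A i `&` A j) z.1 by [].
  by rewrite tA'.
- by apply: bigcupT_measurable => i; exact: measurableI.
Qed.

Let r_cancel i (g : probability T R) B : couplings rho mu g -> measurable B ->
  (r i)^-1%:E * ((r i)%:E * g (B `&` F i)) = g (B `&` F i).
Proof.
move=> cg mB; have [r0|r0] := eqVneq (r i) 0%R; last first.
  by rewrite muleA -EFinM mulVf// mul1e.
suff -> : g (B `&` F i) = 0 by rewrite !mule0.
apply/eqP; rewrite -measure_le0 (@le_trans _ _ (g (F i)))//.
  by rewrite le_measure ?inE//; exact: measurableI.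
by have := cg.1 _ (mA i); rewrite /pushforward -/(F i) => ->; rewrite rE r0.
Qed.

Let glue_fst B : measurable B -> glue_meas (fst @^-1` B) = g0 B.
Proof.
move=> mB; rewrite glueE -(sum_cells g0 mB); apply: eq_eseriesr => i _.
rewrite (_ : fst @^-1` B = B `*` setT); last by apply/seteqP; split=> z //= [].
rewrite product_measure1E//; rewrite [X in _ * X]muleC.
by rewrite -[RHS](r_cancel i cg0 mB); congr (_ * (_ * _)); exact: h1T.
Qed.

Let glue_snd B : measurable B -> glue_meas (snd @^-1` B) = g1 B.
Proof.
move=> mB; rewrite glueE -(sum_cells g1 mB); apply: eq_eseriesr => i _.
rewrite (_ : snd @^-1` B = setT `*` B); last by apply/seteqP; split=> z //= [].
rewrite product_measure1E//.
by rewrite -[RHS](r_cancel i cg1 mB); congr (_ * (_ * _)); exact: h0T.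
Qed.

(** On each cell take the normalised product of the two plans. This couples
    the plans so that their first components share a cell. *)
Lemma glue_cells : exists pi : probability (T * T)%type R,
  couplings g0 g1 pi /\ {ae pi, forall z, exists i, A i z.1.1 /\ A i z.2.1}.
Proof.
have m1 : glue_meas setT = 1.
  by rewrite -(preimage_setT (@fst T T)) glue_fst// probability_setT.
have [pi piE] := probability_of_measure m1.
exists pi; split.
  by split=> B mB; rewrite /pushforward piE; [exact: glue_fst|exact: glue_snd].
pose G := \bigcup_i (F i `*` F i).
have mG : measurable G by apply: bigcupT_measurable => i; exact: measurableX.
exists (~` G); split; first exact: measurableC.
  rewrite piE glueE eseries0// => i _ _.
  have mGc := measurableC mG.
  suff -> : (h0 i \x h1 i) (~` G) = 0 by rewrite mule0.
  pose pm : {measure set (T * T)%type -> \bar R} := h0 i \x h1 i.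
  have N1 : pm.-negligible (~` F i `*` setT).
    apply/negligibleP; first by apply: measurableX => //; exact: measurableC.
    apply: (etrans (product_measure1E (h0 i) (h1 i) (measurableC (mF i)) measurableT)).
    have z0 : h0 i (~` F i) = 0 by rewrite h0E setICl measure0.
    transitivity (0 * h1 i setT); last by rewrite mul0e.
    by congr (_ * _).
  have N2 : pm.-negligible (setT `*` ~` F i).
    apply/negligibleP; first by apply: measurableX => //; exact: measurableC.
    apply: (etrans (product_measure1E (h0 i) (h1 i) measurableT (measurableC (mF i)))).
    have z0 : h1 i (~` F i) = 0 by rewrite h1E setICl measure0.
    transitivity (h0 i setT * 0); last by rewrite mule0.
    by congr (_ * _).
  apply: (measure_negligible mGc : pm.-negligible (~` G) -> pm (~` G) = 0).
  apply: negligibleS (negligibleU N1 N2) => -[x y] nG.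
  have [Fx|] := pselect (F i x); last by left.
  by right; split=> // Fy; apply: nG; exists i.
move=> z /= nz [i _ [h h']]; apply: nz; by exists i.
Qed.

End Gluing.

Section GluingRV.
Context {R : realType} {n : nat}.
Local Notation E := 'rV[R]_n.

(** Gluing exactly along the first marginal would require a disintegration;
    cells of diameter at most [e] suffice and need none. *)
Lemma glue_plans (rho mu : probability E R) (g0 g1 : probability (E * E)%type R) (e : R) :
  couplings rho mu g0 -> couplings rho mu g1 -> 0 < e ->
  exists pi : probability ((E * E) * (E * E))%type R,
    couplings g0 g1 pi /\ {ae pi, forall z, enorm (z.1.1 - z.2.1) <= e}.
Proof.
move=> cg0 cg1 e0.
have n1 : 0 < n%:R + 1 :> R by rewrite ltr_wpDl.
pose dl := e / (2 * (n%:R + 1)); have dl0 : 0 < dl by rewrite divr_gt0// mulr_gt0.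
pose C i : set E := if unpickle i is Some q then ball (ratv q) dl else set0.
have mC i : measurable (C i).
  by rewrite /C; case: unpickle => // q; exact: ball_measurable.
have mA i : measurable (seqDU C i).
  by apply: measurableD => //; exact: bigsetU_measurable.
have UA : \bigcup_i seqDU C i = setT.
  rewrite -seqDU_bigcup_eq; apply/seteqP; split=> // x _.
  have [q hq] := ratv_dense x dl0.
  by exists (pickle q) => //; rewrite /C pickleK; exact: ball_sym.
have [pi [cpi hpi]] := glue_cells cg0 cg1 mA (trivIset_seqDU C) UA.
exists pi; split=> //; apply: filterS hpi => z [i [[h1 _] [h2 _]]].
move: h1 h2; rewrite /C; case: unpickle => // q /(ball_rVP _ _ dl0) h1 /(ball_rVP _ _ dl0) h2.
have hk k : `|(z.1.1 - z.2.1) 0 k| <= 2 * dl.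
  rewrite !mxE; have := h1 k; have := h2 k.
  rewrite !ltr_norml ler_norml => /andP[? ?] /andP[? ?]; apply/andP; split; lra.
rewrite (le_trans (enorm_le_coord hk))//.
have -> : n%:R * (2 * dl) = e * (n%:R / (n%:R + 1)) by rewrite /dl; field; rewrite gt_eqF.
by rewrite ger_pMr// ler_pdivrMr// mul1r lerDl.
Qed.

End GluingRV.

(** * The duality gap of a plan *)

Section GapIntegral.
Context {R : realType} {n : nat}.
Local Notation E := 'rV[R]_n.
Variables (X Y : set E) (rho mu : probability E R) (B : R) (phi psi : E -> R).
Hypothesis mX : measurable X.
Hypothesis mY : measurable Y.
Hypothesis rhoX : rho X = 1%E.
Hypothesis muY : mu Y = 1%E.
Hypothesis hX : forall x, X x -> enorm x <= B.
Hypothesis hY : forall y, Y y -> enorm y <= B.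
Hypothesis pp : potential_pair Y phi psi.
Hypothesis psi_lip : forall y y', psi y - psi y' <= B * enorm (y - y').

(** The gap is nonnegative over [Y] only; the positive part agrees with it
    almost everywhere for the plans considered and can be integrated without
    an integrability condition. *)
Definition gap_pos (p : E * E) : R := Num.max 0 (gap phi psi p.1 p.2).

Lemma measurable_dot d (T : measurableType d) (f g : T -> E) :
  measurable_fun setT f -> measurable_fun setT g ->
  measurable_fun setT (fun t => dot (f t) (g t)).
Proof.
move=> mf mg; apply: measurable_sum => i.
by apply: measurable_funM; exact: measurable_comp_coord.
Qed.

Let mphi : measurable_fun setT phi := measurable_potential hY pp.
Let mpsi : measurable_fun setT psi := lipschitz_measurable psi_lip.

Lemma measurable_gap_pos : measurable_fun setT gap_pos.
Proof.
apply: measurable_maxr; first exact: measurable_cst.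
apply: measurable_funB; last exact: measurable_dot.
by apply: measurable_funD; [exact: (measurableT_comp mphi)|exact: (measurableT_comp mpsi)].
Qed.

Lemma gap_pos_ge0 p : 0 <= gap_pos p.
Proof. by rewrite le_max lexx. Qed.

(** |x - y|^2 is 2 * gap plus a function of [x] plus a function of [y], and the
    integrals of the latter two depend on the marginals alone. The constant [K]
    makes these functions nonnegative on the domains. *)
Lemma quad_cost_decomposition : exists (K : R) (Ca : \bar R),
  forall g, couplings rho mu g ->
    (quad_cost g + K%:E = Ca + \int[g]_p (2 * gap_pos p)%:E)%E.
Proof.
pose Kx := 2 * (`|phi 0| + B * B); pose Ky := 2 * (`|psi 0| + B * B).
pose a x := Num.max 0 (dot x x - 2 * phi x + Kx).
pose b y := Num.max 0 (dot y y - 2 * psi y + Ky).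
have a0 x : 0 <= a x by rewrite le_max lexx.
have b0 y : 0 <= b y by rewrite le_max lexx.
have ma : measurable_fun setT (fun x => (a x)%:E : \bar R).
  apply/measurable_EFinP; apply: measurable_maxr; first exact: measurable_cst.
  apply: measurable_funD => //; apply: measurable_funB; first exact: measurable_dot.
  exact: measurable_funM.
have mb : measurable_fun setT (fun x => (b x)%:E : \bar R).
  apply/measurable_EFinP; apply: measurable_maxr; first exact: measurable_cst.
  apply: measurable_funD => //; apply: measurable_funB; first exact: measurable_dot.
  exact: measurable_funM.
have mg : measurable_fun setT (fun p => (2 * gap_pos p)%:E : \bar R).
  by apply/measurable_EFinP; apply: measurable_funM => //; exact: measurable_gap_pos.
exists (Kx + Ky), (\int[rho]_x (a x)%:E + \int[mu]_y (b y)%:E)%E => g cg.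
have aE x : X x -> a x = dot x x - 2 * phi x + Kx.
  move=> Xx; apply/max_idPr.
  have h1 := potential_lipschitz hY pp x 0; rewrite subr0 in h1.
  have B0 : 0 <= B by rewrite (le_trans (enorm_ge0 x))// hX.
  have h2 : B * enorm x <= B * B by rewrite ler_wpM2l// hX.
  have := dotxx_ge0 x; have := ler_norm (phi 0); rewrite /Kx; lra.
have bE y : Y y -> b y = dot y y - 2 * psi y + Ky.
  move=> Yy; apply/max_idPr.
  have h1 := psi_lip y 0; rewrite subr0 in h1.
  have B0 : 0 <= B by rewrite (le_trans (enorm_ge0 y))// hY.
  have h2 : B * enorm y <= B * B by rewrite ler_wpM2l// hY.
  have := dotxx_ge0 y; have := ler_norm (psi 0); rewrite /Ky; lra.
rewrite -(integral_coupling_fst cg ma); last by move=> x; rewrite lee_fin.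
rewrite -(integral_coupling_snd cg mb); last by move=> x; rewrite lee_fin.
have g2 p : (0 <= (2 * gap_pos p)%:E :> \bar R)%E by rewrite lee_fin mulr_ge0 ?gap_pos_ge0.
have ma' : measurable_fun setT (fun p : E * E => (a p.1)%:E : \bar R) := measurableT_comp ma measurable_fst.
have mb' : measurable_fun setT (fun p : E * E => (b p.2)%:E : \bar R) := measurableT_comp mb measurable_snd.
rewrite -ge0_integralD//; last 2 first.
- by move=> p _; rewrite lee_fin.
- by move=> p _; rewrite lee_fin.
rewrite -ge0_integralD//; last 2 first.
- by move=> p _; rewrite adde_ge0// lee_fin.
- exact: emeasurable_funD.
have K0 : 0 <= Kx + Ky by rewrite /Kx /Ky !addr_ge0// mulr_ge0// addr_ge0// -expr2 sqr_ge0.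
have -> : (Kx + Ky)%:E = (\int[g]_p (Kx + Ky)%:E)%E :> \bar R.
  by rewrite integral_cst//= probability_setT mule1.
rewrite -ge0_integralD//; last 2 first.
- by move=> p _; rewrite lee_fin sqr_ge0.
- exact: measurable_sqdist.
apply: ae_eq_integral => //.
- by apply: emeasurable_funD => //; exact: measurable_sqdist.
- by apply: emeasurable_funD => //; exact: emeasurable_funD.
have := ae_coupling_fst cg (probability1_ae mX rhoX); have := ae_coupling_snd cg (probability1_ae mY muY).
apply: filterS2 => p Yp Xp _.
rewrite /gap_pos max_r; last exact: (gap_ge0 pp).
rewrite aE// bE// -!EFinD; congr EFin.
by rewrite sqr_enorm !(dotBl, dotBr) (dotC p.2 p.1) /gap; ring.
Qed.

Lemma quad_cost_gap (go g : probability (E * E)%type R) :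
  couplings rho mu go -> couplings rho mu g ->
  {ae go, forall p, gap phi psi p.1 p.2 = 0} ->
  (quad_cost g = quad_cost go + \int[g]_p (2 * gap_pos p)%:E)%E.
Proof.
move=> cgo cg go0; have [K [Ca hK]] := quad_cost_decomposition.
have ho := hK _ cgo; have h := hK _ cg.
have z : (\int[go]_p (2 * gap_pos p)%:E = 0 :> \bar R)%E.
  transitivity (\int[go]_p (0 : \bar R))%E; last by rewrite integral0.
  apply: ae_eq_integral => //.
    by apply/measurable_EFinP; apply: measurable_funM => //; exact: measurable_gap_pos.
  by apply: filterS go0 => p hp _; rewrite /gap_pos hp maxxx mulr0.
rewrite z adde0 in ho; rewrite -ho in h.
by rewrite -[LHS](@addeK _ K%:E)// h addeAC addeK.
Qed.

End GapIntegral.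

(** * Real inequalities *)

Section RealInequalities.
Context {R : realType}.
Implicit Types (a w K k t th I q x y : R).

Lemma powR_le_mul q y D : 1 <= q -> 0 <= y <= D -> y `^ q <= y * D `^ (q - 1).
Proof.
move=> q1 /andP[y0 yD]; rewrite -(mulr_powRB1 y0); last by rewrite (lt_le_trans ltr01).
by rewrite ler_wpM2l// ge0_ler_powR ?subr_ge0// nnegrE (le_trans y0).
Qed.

Lemma ler_powR_base p x y : 0 <= p -> 0 <= x -> x <= y -> x `^ p <= y `^ p.
Proof. by move=> p0 x0 xy; rewrite ge0_ler_powR// nnegrE (le_trans x0). Qed.

(** The scale [t] balances the three terms: it is the larger of the solutions
    of [a / t = t `^ th] and [t = w `^ k]. *)
Lemma optimise_scale I a w K k th : 0 <= a -> 0 <= w -> 0 <= K -> 0 < k -> 0 < th ->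
  (forall t, 0 < t -> w `^ k <= t -> I <= a / (2 * t) + w `^ (k * th) + K * t `^ th) ->
  I <= (1 + K) * (a `^ (th / (1 + th)) + w `^ (k * th)).
Proof.
move=> a0 w0 K0 k0 th0 hI.
have th1 : 0 < 1 + th by rewrite addr_gt0.
pose ta := a `^ (1 + th)^-1; pose tw := w `^ k.
have ta0 : 0 <= ta by exact: powR_ge0.
have tw0 : 0 <= tw by exact: powR_ge0.
have taE : ta `^ th = a `^ (th / (1 + th)) by rewrite -powRrM mulrC.
have twE : tw `^ th = w `^ (k * th) by rewrite -powRrM.
rewrite -taE -twE; rewrite -twE in hI.
pose t := Num.max ta tw.
have t_le : t `^ th <= ta `^ th + tw `^ th.
  rewrite /t; case: (leP ta tw) => _; [rewrite lerDr|rewrite lerDl]; exact: powR_ge0.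
have [t0|t0] := ltP 0 t.
  have := hI t t0; rewrite le_max lexx orbT => /(_ isT) /le_trans; apply.
  have h1 : a / (2 * t) <= ta `^ th.
    rewrite ler_pdivrMr ?mulr_gt0//.
    have [->|an0] := eqVneq a 0; first by rewrite mulr_ge0 ?powR_ge0// mulr_ge0// ltW.
    have aE : a = ta `^ th * ta.
      rewrite -[X in _ * X](powRr1 ta0) -powRD; last by rewrite addrC gt_eqF.
      by rewrite -powRrM [th + 1]addrC mulVf ?gt_eqF// powRr1.
    rewrite {1}aE ler_wpM2l ?powR_ge0//.
    have : ta <= t by rewrite le_max lexx.
    by move=> /le_trans; apply; rewrite mulr_natl mulr2n lerDl ltW.
  have h2 : K * t `^ th <= K * (ta `^ th + tw `^ th) by rewrite ler_wpM2l.
  rewrite [leRHS]mulrDl [X in _ <= X + _]mul1r; apply: lerD => //.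
  by rewrite lerD2r.
(* here [a] and [w] vanish, and letting the scale tend to 0 gives [I <= 0] *)
have ta_0 : ta = 0 by apply/le_anti; rewrite ta0 andbT (le_trans _ t0)// le_max lexx.
have tw_0 : tw = 0 by apply/le_anti; rewrite tw0 andbT (le_trans _ t0)// le_max lexx orbT.
have a_0 : a = 0.
  by apply/eqP; move/eqP: ta_0; rewrite /ta powR_eq0 => /andP[].
rewrite ta_0 tw_0 powR0 ?gt_eqF// addr0 mulr0.
have hI' t' : 0 < t' -> I <= K * t' `^ th.
  move=> t'0; have := hI t' t'0; rewrite -/tw tw_0 a_0 mul0r powR0 ?gt_eqF// !add0r.
  by apply; exact: ltW.
rewrite leNgt; apply/negP => I0.
have [K_0|Kn0] := eqVneq K 0; first by have := hI' 1 ltr01; rewrite K_0 mul0r leNgt I0.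
have Kp : 0 < K by rewrite lt_neqAle eq_sym Kn0.
pose t' := (I / (2 * K)) `^ th^-1.
have t'0 : 0 < t' by rewrite powR_gt0// divr_gt0// mulr_gt0.
have := hI' t' t'0; rewrite -powRrM mulVf ?gt_eqF// powRr1; last by rewrite divr_ge0 ?ltW// mulr_gt0.
have -> : K * (I / (2 * K)) = I / 2 by field; rewrite gt_eqF.
by rewrite leNgt ltr_pdivrMr// ltr_pMr// ltr1n.
Qed.

Lemma bernoulli_inv x m : 0 <= x -> (1 + x) ^+ m * (1 - m%:R * x) <= 1.
Proof.
move=> x0; elim: m => [|m IH]; first by rewrite expr0 mul0r subr0 mul1r.
apply: le_trans IH; rewrite exprSr -mulrA ler_wpM2l ?exprn_ge0 ?addr_ge0//.
by rewrite -natr1; have := ler0n R m; nra.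
Qed.

(** At scales below [D / c] the boundary layer of the ball of radius [D] is
    negligible in the volume count. *)
Lemma volume_count (n : nat) (c D eta : R) : (2 <= n)%N -> 0 < D -> 0 < eta ->
  24 * n%:R ^+ 2 * (n%:R + 1) <= c -> eta * c <= D ->
  18 * n%:R ^+ 3 * (D + eta + 3 * n%:R * eta) ^+ n.-1 <= c * D ^+ n.-1.
Proof.
case: n => // n; rewrite ltnS => n1 D0 e0 hc hD /=.
set N : R := n.+1%:R.
have N2 : 2 <= N by rewrite ler_nat ltnS.
have nE : n%:R = N - 1 :> R by rewrite /N -natr1 addrK.
have c0 : 0 < c by rewrite (lt_le_trans _ hc)// !mulr_gt0// ?exprn_gt0//; lra.
pose x := (1 + 3 * N) * eta / D.
have N31 : 0 <= 1 + 3 * N by lra.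
have x0 : 0 <= x by exact: divr_ge0 (mulr_ge0 N31 (ltW e0)) (ltW D0).
have -> : D + eta + 3 * N * eta = D * (1 + x).
  by rewrite /x; field; rewrite gt_eqF.
rewrite exprMn mulrCA [leRHS]mulrC ler_pM2l ?exprn_gt0//.
have hx : n%:R * x <= 24^-1.
  have e1 : eta / D <= c^-1 by rewrite ler_pdivrMr// mulrC ler_pdivlMr.
  have e2 : c^-1 <= (24 * N ^+ 2 * (N + 1))^-1.
    by rewrite lef_pV2// posrE !mulr_gt0// ?exprn_gt0//; lra.
  have e3 : (1 + 3 * N) * (N - 1) <= N ^+ 2 * (N + 1) by nra.
  rewrite nE /x mulrA (_ : _ * _ / D = (1 + 3 * N) * (N - 1) * (eta / D)); last by ring.
  apply: (@le_trans _ _ ((1 + 3 * N) * (N - 1) * (24 * N ^+ 2 * (N + 1))^-1)).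
    by rewrite ler_wpM2l ?(le_trans e1)// mulr_ge0//; lra.
  rewrite ler_pdivrMr; last by rewrite !mulr_gt0// ?exprn_gt0//; lra.
  by rewrite !mulrA mulVf// mul1r.
have hb := @bernoulli_inv x n x0.
have p0 : 0 <= (1 + x) ^+ n by rewrite exprn_ge0// addr_ge0.
have hp : (1 + x) ^+ n <= 24 / 23 by nra.
rewrite (le_trans _ hc)//.
have N3 : 0 <= 18 * N ^+ 3 by rewrite mulr_ge0// exprn_ge0//; lra.
apply: (le_trans (ler_wpM2l N3 hp)).
rewrite (_ : 18 * N ^+ 3 * (24 / 23) = 24 * N ^+ 2 * (18 / 23 * N)); last by field.
rewrite ler_wpM2l//; last by lra.
by rewrite mulr_ge0// sqr_ge0.
Qed.

End RealInequalities.

(** * The estimate at a fixed scale *)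

Section CompactSets.
Context {R : realType} {n : nat}.
Local Notation E := 'rV[R]_n.

Lemma compact_enorm_bounded (X : set E) : compact X ->
  exists2 B, 0 <= B & forall x, X x -> enorm x <= B.
Proof.
move=> /compact_bounded[M [_ hM]].
exists (n%:R * (`|M| + 1)); first by rewrite mulr_ge0// addr_ge0.
move=> x Xx; apply: enorm_le_coord => i.
have : `|x| <= `|M| + 1 by apply: hM => //; rewrite (le_lt_trans (ler_norm _))// ltrDl.
apply: le_trans; rewrite {2}/Num.Def.normr /= mx_normrE.
exact: (@le_bigmax _ _ _ 0 (fun ij : 'I_1 * 'I_n => `|x ij.1 ij.2|) (0, i)).
Qed.

Lemma dist_le_diam (X : set E) x y : compact X -> X x -> X y -> enorm (x - y) <= diam X.
Proof.
move=> /compact_enorm_bounded[B B0 hB] Xx Xy; apply: ub_le_sup; last by exists (x, y).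
exists (B + B) => _ [[x' y'] [/= Xx' Xy'] <-].
by rewrite (le_trans (enormD _ _))// enormN lerD// hB.
Qed.

Lemma probability_nonempty (rho : probability E R) (X : set E) : rho X = 1%E -> X !=set0.
Proof.
move=> h; apply/set0P/eqP => X0; move: h; rewrite X0 measure0 => /eqP.
by rewrite eq_sym onee_eq0.
Qed.

(** Balls of radius slightly larger than [D] contain [X], so have mass 1. *)
Lemma small_balls_diam (rho : probability E R) (X : set E) x0 (M D p : R) :
  measurable X -> rho X = 1%E -> (forall x, X x -> enorm (x - x0) <= D) -> 0 <= D ->
  0 < M -> 0 < p ->
  (forall eta, 0 < eta -> (rho (eball x0 eta) <= (M * eta `^ p)%:E)%E) ->
  0 < D /\ 1 <= M * D `^ p.
Proof.
move=> mX rhoX hX D0 M0 p0 hball.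
pose D1 := M^-1 `^ p^-1.
have D1p : D1 `^ p = M^-1 by rewrite -powRrM mulVf ?gt_eqF// powRr1// invr_ge0 ltW.
have D10 : 0 < D1 by rewrite powR_gt0// invr_gt0.
have D1D : D1 <= D.
  rewrite leNgt; apply/negP => DD1.
  pose eta := (D + D1) / 2.
  have eta0 : 0 < eta by rewrite divr_gt0// ltr_wpDl.
  have eta1 : eta < D1 by rewrite /eta; lra.
  have eta2 : D < eta by rewrite /eta; lra.
  have h1 : (1 <= rho (eball x0 eta))%E.
    rewrite -rhoX le_measure ?inE//; first exact: eball_measurable.
    by move=> x /hX hx; rewrite /eball/= (le_lt_trans hx).
  have := le_trans h1 (hball eta eta0); rewrite lee_fin leNgt => /negP; apply.
  rewrite mulrC -ltr_pdivlMr// div1r -D1p.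
  by apply: gt0_ltr_powR => //; rewrite nnegrE ltW.
split; first exact: lt_le_trans D10 D1D.
rewrite mulrC -ler_pdivrMr// div1r -D1p.
by apply: ler_powR_base => //; rewrite ltW.
Qed.

End CompactSets.

Section FixedScale.
Context {R : realType} {d : nat}.
Local Notation E := 'rV[R]_d.
Variables (X Y : set E) (phi psi : E -> R) (B DX DY M theta c : R) (x0 : E).
Hypothesis d2 : (2 <= d)%N.
Hypothesis hY : forall y, Y y -> enorm y <= B.
Hypothesis hDX : forall x, X x -> enorm (x - x0) <= DX.
Hypothesis hDY : forall y y', Y y -> Y y' -> enorm (y - y') <= DY.
Hypothesis DY0 : 0 <= DY.
Hypothesis pp : potential_pair Y phi psi.
Hypothesis mX : measurable X.
Hypothesis M0 : 0 < M.
Hypothesis theta01 : 0 < theta <= 1.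
Hypothesis hc : 24 * d%:R ^+ 2 * (d%:R + 1) <= c.

Lemma c_ge1 : 1 <= c.
Proof.
have D2 : 2 <= d%:R :> R by rewrite ler_nat.
by apply: le_trans hc; nra.
Qed.

Section OscillationBound.
Variables (rho rhot : probability E R) (sigma : probability (E * E)%type R) (eta : R).
Hypothesis rhotX : rhot X = 1%E.
Hypothesis X0 : X x0.
Hypothesis hball : forall x eta, 0 < eta ->
  (rhot (eball x eta) <= (M * eta `^ (d%:R - 1 + theta))%:E)%E.
Hypothesis csigma : couplings rho rhot sigma.
Hypothesis eta0 : 0 < eta.

Let p := d%:R - 1 + theta.

Lemma exponent_gt0 : 0 < p.
Proof.
have D2 : 2 <= d%:R :> R by rewrite ler_nat.
by have /andP[t0 _] := theta01; rewrite /p; lra.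
Qed.

Lemma measure_diam : 0 < DX /\ 1 <= M * DX `^ p.
Proof.
apply: (small_balls_diam mX rhotX hDX) => //; last by move=> e e0; exact: hball.
- by rewrite (le_trans (enorm_ge0 (x0 - x0)))// hDX.
- exact: exponent_gt0.
Qed.

(** If [eta] is at least [DX / c], the right-hand side dominates the trivial
    bound [DY], because [M * DX `^ p] is at least 1. For smaller [eta] the averaged
    bound applies and the volume count turns its constants into [c]. *)
Lemma osc2_integral_le :
  (\int[rho]_x (Num.min DY (osc2 phi eta x / eta))%:E <=
   DY%:E * sigma [set z : E * E | (eta < enorm (z.1 - z.2))%R]
   + (DY * (c * M * DX `^ p * (eta / DX) `^ theta))%:E)%E.
Proof.
have [DX0 A1] := measure_diam; have /andP[t0 t1] := theta01.
have c1 := c_ge1; have c0 : 0 < c by rewrite (lt_le_trans ltr01).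
have A0 : 0 <= M * DX `^ p by rewrite (le_trans ler01).
have mo : measurable_fun setT (fun x : E => (Num.min DY (osc2 phi eta x / eta))%:E : \bar R).
  apply/measurable_EFinP; apply: measurable_minr; first exact: measurable_cst.
  by apply: measurable_funM => //; apply: (measurable_osc2 hY pp); exact: ltW.
have [big|small] := leP DX (eta * c).
  apply: (@le_trans _ _ DY%:E).
    apply: (@le_trans _ _ (\int[rho]_x DY%:E)%E); last first.
      by rewrite integral_cst//= probability_setT mule1.
    apply: ge0_le_integral => //.
    - by move=> x _; rewrite lee_fin le_min DY0 divr_ge0 ?(osc2_ge0 hY pp) ?ltW.
    - by move=> x _; rewrite lee_fin ge_min lexx.
  apply: (@le_trans _ _ (DY * (c * M * DX `^ p * (eta / DX) `^ theta))%:E); last first.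
    by rewrite leeDr// mule_ge0// lee_fin.
  rewrite lee_fin ler_peMr//.
  have e1 : c^-1 <= eta / DX by rewrite ler_pdivlMr// mulrC ler_pdivrMr.
  have ci : 0 < c^-1 <= 1 by rewrite invr_gt0 c0 invf_le1.
  have e2 : c^-1 <= (eta / DX) `^ theta.
    apply: (le_trans (ger1_powR ci t1)).
    by apply: ler_powR_base e1; [exact: ltW|rewrite invr_ge0 ltW].
  have e3 : 1 <= c * (eta / DX) `^ theta by rewrite mulrC -ler_pdivrMr// div1r.
  rewrite (_ : c * M * _ * _ = M * DX `^ p * (c * (eta / DX) `^ theta)); last by ring.
  by rewrite -[leLHS]mulr1; apply: ler_pM.
have d0 : (0 < d)%N by rewrite (leq_trans _ d2).
have DXge : 0 <= DX by rewrite ltW.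
have Me0 : 0 <= M * eta `^ p by rewrite mulr_ge0 ?powR_ge0// ltW.
apply: le_trans (integral_osc2 hY hDY pp d0 eta0 Me0 DXge DY0 hDX mX rhotX (fun x => hball x eta0) csigma) _.
rewrite leeD2l// lee_fin.
set N : R := d%:R; set r := 3 * N * eta; set s := DX + eta.
have r0 : 0 <= r by rewrite !mulr_ge0// ltW.
have s0 : 0 <= s by rewrite addr_ge0// ltW.
have h1 := subXX_le d s0 r0.
have h2 := volume_count d2 DX0 eta0 hc (ltW small).
rewrite -/N -/s -/r in h2.
have em0 : 0 < eta ^+ d.-1 by rewrite exprn_gt0.
have eE : eta ^+ d = eta * eta ^+ d.-1 by rewrite -exprS prednK.
have pE x : 0 < x -> x `^ p = x ^+ d.-1 * x `^ theta.
  move=> x_gt0; rewrite -powR_mulrn; last exact: ltW.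
  rewrite -powRD; last by rewrite (gt_eqF x_gt0) implybT.
  by rewrite /p -subn1 natrB.
have tE : (eta / DX) `^ theta = eta `^ theta / DX `^ theta.
  by rewrite powRM ?ltW ?invr_gt0// -[DX^-1]powR_inv1// -powRAC powR_inv1// powR_ge0.
have dt0 : 0 < DX `^ theta by rewrite powR_gt0.
have et0 : 0 < eta `^ theta by rewrite powR_gt0.
have -> : DY * (c * M * DX `^ p * (eta / DX) `^ theta) =
    DY * M * eta `^ theta * (c * DX ^+ d.-1).
  by rewrite (pE _ DX0) tE; field; rewrite gt_eqF.
apply: (@le_trans _ _ (DY * M * eta `^ theta * (18 * N ^+ 3 * (s + r) ^+ d.-1))); last first.
  by apply: ler_wpM2l h2; rewrite !mulr_ge0// ltW.
rewrite (pE _ eta0) eE.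
have -> : M * (eta ^+ d.-1 * eta `^ theta) * 2 * (r * DY * ((s + r) ^+ d - s ^+ d)) /
    (eta * (eta * eta ^+ d.-1)) =
    DY * M * eta `^ theta * (6 * N / eta * ((s + r) ^+ d - s ^+ d)).
  by rewrite /r; field; rewrite !gt_eqF.
apply: ler_wpM2l; first by rewrite !mulr_ge0// ltW.
have -> : 18 * N ^+ 3 * (s + r) ^+ d.-1 = 6 * N / eta * (N * r * (s + r) ^+ d.-1).
  by rewrite /r; field; rewrite gt_eqF.
by apply: ler_wpM2l h1; rewrite !mulr_ge0// invr_ge0 ltW.
Qed.

End OscillationBound.

End FixedScale.

Section PlanDistance.
Context {R : realType} {d : nat}.
Local Notation E := 'rV[R]_d.
Variables (Y : set E) (phi psi : E -> R) (B DY q eta : R).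
Variables (rho mu : probability E R) (go g : probability (E * E)%type R).
Hypothesis hY : forall y, Y y -> enorm y <= B.
Hypothesis B0 : 0 <= B.
Hypothesis hDY : forall y y', Y y -> Y y' -> enorm (y - y') <= DY.
Hypothesis DY0 : 0 <= DY.
Hypothesis pp : potential_pair Y phi psi.
Hypothesis psi_lip : forall y y', psi y - psi y' <= B * enorm (y - y').
Hypothesis mY : measurable Y.
Hypothesis muY : mu Y = 1%E.
Hypothesis q1 : 1 <= q.
Hypothesis eta0 : 0 < eta.
Hypothesis cgo : couplings rho mu go.
Hypothesis cg : couplings rho mu g.
Hypothesis go0 : {ae go, forall p, gap phi psi p.1 p.2 = 0}.

Let h x := Num.min DY (osc2 phi eta x / eta).
Let k := DY `^ (q - 1).

Let h_ge0 x : 0 <= h x.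
Proof. by rewrite le_min DY0 divr_ge0 ?(osc2_ge0 hY pp) ?ltW. Qed.

Let mh : measurable_fun setT (fun x => (h x)%:E : \bar R).
Proof.
apply/measurable_EFinP; apply: measurable_minr; first exact: measurable_cst.
by apply: measurable_funM => //; apply: (measurable_osc2 hY pp); exact: ltW.
Qed.

Let mgap : measurable_fun setT (fun p => (gap_pos phi psi p)%:E : \bar R).
Proof. apply/measurable_EFinP; exact: (measurable_gap_pos hY pp psi_lip). Qed.

(** The second plan is compared with the first at [x0], where the potential has
    [y0] as a subgradient; moving its pair from [x1] to [x0] changes the gap by
    at most [2 * B * e]. *)
Let dist_le_gap e (x0 y0 x1 y1 : E) : Y y0 -> Y y1 -> gap phi psi x0 y0 = 0 ->
  enorm (x0 - x1) <= e ->
  enorm (y0 - y1) <= eta^-1 * gap_pos phi psi (x1, y1) + (2 * B * e / eta + h x0).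
Proof.
move=> Y0 Y1 g0 hx.
have e0 : 0 <= e by rewrite (le_trans (enorm_ge0 _) hx).
have gp : gap phi psi x1 y1 <= gap_pos phi psi (x1, y1) by rewrite le_max lexx orbT.
have gp0 : 0 <= gap_pos phi psi (x1, y1) by exact: gap_pos_ge0.
rewrite addrA -lerBlDl le_min; apply/andP; split.
  rewrite lerBlDl (le_trans (hDY Y0 Y1))// lerDr addr_ge0// mulr_ge0//.
  - by rewrite invr_ge0 ltW.
  - by rewrite !mulr_ge0.
  - by rewrite invr_ge0 ltW.
have h1 := dist_le_gap_osc2 hY pp x0 eta0 Y0 Y1; rewrite g0 add0r in h1.
have h2 : gap phi psi x0 y1 <= gap_pos phi psi (x1, y1) + 2 * B * e.
  have l1 := potential_lipschitz hY pp x0 x1.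
  have l2 := cauchy_schwarz (x1 - x0) y1; rewrite dotBl in l2.
  have l3 : enorm (x1 - x0) * enorm y1 <= e * B.
    by apply: ler_pM; rewrite ?enorm_ge0 ?hY// enormBC.
  have l4 : B * enorm (x0 - x1) <= B * e by rewrite ler_wpM2l.
  rewrite /gap in gp *; lra.
rewrite ler_pdivlMr// mulrBl.
rewrite (_ : (eta^-1 * gap_pos phi psi (x1, y1) + 2 * B * e / eta) * eta =
  gap_pos phi psi (x1, y1) + 2 * B * e); last by field; rewrite gt_eqF.
rewrite mulrC; lra.
Qed.

(** The approximately glued plans compare second marginals over nearby first
    marginals; letting them become exact leaves the gap and the oscillation. *)
Lemma plan_distance_le :
  (ereal_inf [set \int[pi]_z (enorm (z.1.1 - z.2.1) `^ q + enorm (z.1.2 - z.2.2) `^ q)%R%:E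
    | pi in couplings go g]
   <= k%:E * ((eta^-1)%:E * \int[g]_p (gap_pos phi psi p)%:E + \int[rho]_x (h x)%:E))%E.
Proof.
have k0 : 0 <= k by exact: powR_ge0.
have C0 : 0 < 1 + k * (2 * B / eta).
  by rewrite ltr_pwDl// mulr_ge0// divr_ge0 ?mulr_ge0// ltW.
apply/lee_addgt0Pr => e' e'0.
pose e := Num.min 1 (e' / (1 + k * (2 * B / eta))).
have e0 : 0 < e by rewrite lt_min ltr01 divr_gt0.
have e1 : 0 < e <= 1 by rewrite e0 ge_min lexx.
have ee' : e + k * (2 * B * e / eta) <= e'.
  rewrite (_ : _ + _ = e * (1 + k * (2 * B / eta))); last by ring.
  by rewrite -ler_pdivlMr// ge_min lexx orbT.
have [pi [cpi hpi]] := glue_plans cgo cg e0.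
apply: (@le_trans _ _ (\int[pi]_z (enorm (z.1.1 - z.2.1) `^ q + enorm (z.1.2 - z.2.2) `^ q)%R%:E)%E).
  by apply: ereal_inf_lbound; exists pi.
have mgz : measurable_fun setT (fun z : (E * E) * (E * E) => (gap_pos phi psi z.2)%:E : \bar R) :=
  measurableT_comp mgap measurable_snd.
have mho : measurable_fun setT (fun p : E * E => (h p.1)%:E : \bar R) :=
  measurableT_comp mh measurable_fst.
have mhz : measurable_fun setT (fun z : (E * E) * (E * E) => (h z.1.1)%:E : \bar R) :=
  measurableT_comp mho measurable_fst.
have gE0 p : (0 <= (gap_pos phi psi p)%:E :> \bar R)%E by rewrite lee_fin gap_pos_ge0.
have hE0 x : (0 <= (h x)%:E :> \bar R)%E by rewrite lee_fin.
have i0 : 0 <= eta^-1 by rewrite invr_ge0 ltW.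
have inner_meas : measurable_fun setT (fun z : (E * E) * (E * E) =>
    ((eta^-1)%:E * (gap_pos phi psi z.2)%:E + (h z.1.1)%:E)%E).
  by apply: emeasurable_funD => //; exact: emeasurable_funM.
have inner0 (z : (E * E) * (E * E)) : (0 <= (eta^-1)%:E * (gap_pos phi psi z.2)%:E + (h z.1.1)%:E :> \bar R)%E.
  by rewrite adde_ge0// mule_ge0// lee_fin.
apply: (@le_trans _ _ (\int[pi]_z (e'%:E +
    k%:E * ((eta^-1)%:E * (gap_pos phi psi z.2)%:E + (h z.1.1)%:E)))%E); last first.
  rewrite ge0_integralD//; last 3 first.
  - by move=> z _; rewrite lee_fin ltW.
  - by move=> z _; apply: mule_ge0 (inner0 z); rewrite lee_fin.
  - exact: emeasurable_funM.
  rewrite integral_cst//= probability_setT mule1 addeC leeD2r//.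
  rewrite ge0_integralZl_EFin// lee_wpmul2l ?lee_fin//.
  rewrite ge0_integralD//; last 2 first.
  - by move=> z _; rewrite mule_ge0// lee_fin.
  - exact: emeasurable_funM.
  rewrite ge0_integralZl_EFin//.
  rewrite (integral_coupling_snd cpi mgap gE0).
  rewrite (integral_coupling_fst cpi mho); last by move=> p; exact: hE0.
  by rewrite (integral_coupling_fst cgo mh hE0).
apply: ae_ge0_le_integral => //.
- by move=> z _; rewrite lee_fin addr_ge0// powR_ge0.
- have md1 : measurable_fun setT (fun z : (E * E) * (E * E) => enorm (z.1.1 - z.2.1)).
    apply: measurable_enorm; apply: measurable_rVB.
      exact: (measurableT_comp measurable_fst).
    exact: (measurableT_comp measurable_fst).
  have md2 : measurable_fun setT (fun z : (E * E) * (E * E) => enorm (z.1.2 - z.2.2)).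
    apply: measurable_enorm; apply: measurable_rVB.
      exact: (measurableT_comp measurable_snd).
    exact: (measurableT_comp measurable_snd).
  apply/measurable_EFinP; apply: measurable_funD.
    exact: (measurableT_comp (measurable_powR q) md1).
  exact: (measurableT_comp (measurable_powR q) md2).
- move=> z _; apply: adde_ge0; first by rewrite lee_fin ltW.
  by apply: mule_ge0 (inner0 z); rewrite lee_fin.
- by apply: emeasurable_funD => //; exact: emeasurable_funM.
have a1 := ae_coupling_fst cpi go0.
have a2 := ae_coupling_fst cpi (ae_coupling_snd cgo (probability1_ae mY muY)).
have a3 := ae_coupling_snd cpi (ae_coupling_snd cg (probability1_ae mY muY)).
have a12 : {ae pi, forall z, gap phi psi z.1.1 z.1.2 = 0 /\ Y z.1.2}.
  by move: a1 a2; apply: filterS2.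
move: hpi a12 a3; apply: filterS3 => -[[x0 y0] [x1 y1]] /= hx [g0 Y0] Y1 _.
rewrite -?EFinM -?EFinD -?EFinM -?EFinD lee_fin.
have hy := dist_le_gap Y0 Y1 g0 hx.
have hxq : enorm (x0 - x1) `^ q <= e.
  apply: (@le_trans _ _ (e `^ q)); last exact: ge1r_powR.
  by apply: ler_powR_base; rewrite ?enorm_ge0// (le_trans ler01).
have hyq : enorm (y0 - y1) `^ q <= enorm (y0 - y1) * k.
  by apply: powR_le_mul => //; rewrite enorm_ge0 hDY.
apply: (le_trans (lerD hxq hyq)); rewrite mulrC.
apply: (le_trans (lerD (lexx e) (ler_wpM2l k0 hy))).
rewrite addrCA mulrDr addrA; exact: lerD ee' (lexx _).
Qed.

End PlanDistance.

(** * Mass of distant pairs and exponents *)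

Section Assembly.
Context {R : realType}.

(** Concavity: each share [t] of the sum satisfies [t <= t `^ s]. *)
Lemma powR_subadd (s x y : R) : 0 < s <= 1 -> 0 <= x -> 0 <= y ->
  (x + y) `^ s <= x `^ s + y `^ s.
Proof.
move=> /andP[s0 s1] x0 y0; have [S0|Sn0] := eqVneq (x + y) 0.
  by rewrite S0 powR0 ?gt_eqF// addr_ge0 ?powR_ge0.
have S0 : 0 < x + y by rewrite lt_neqAle eq_sym Sn0 addr_ge0.
have frac t : 0 <= t -> t <= x + y -> t / (x + y) <= (t / (x + y)) `^ s.
  move=> t0 tS; have [->|tn0] := eqVneq t 0; first by rewrite mul0r powR_ge0.
  apply: ger1_powR => //; rewrite divr_gt0 ?ler_pdivrMr ?mul1r//.
  by rewrite lt_neqAle eq_sym tn0.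
have split t : 0 <= t -> t `^ s = (t / (x + y)) `^ s * (x + y) `^ s.
  by move=> t0; rewrite -powRM ?divr_ge0 ?(ltW S0)// divfK.
rewrite (split x)// (split y)// -mulrDl ler_peMl ?powR_ge0//.
have -> : 1 = x / (x + y) + y / (x + y) by rewrite -mulrDl mulfV.
by apply: lerD; apply: frac => //; rewrite ?lerDl ?lerDr.
Qed.

Context {d : nat}.
Local Notation E := 'rV[R]_d.
Local Notation dist := (fun z : E * E => (enorm (z.1 - z.2))%:E : \bar R).

Lemma Lnorm_dist_powR (s : probability (E * E)%type R) (r : R) : r != 0 ->
  ('N[s]_r%:E[dist] `^ r = \int[s]_z (enorm (z.1 - z.2) `^ r)%:E)%E.
Proof.
move=> r0; rewrite poweR_Lnorm//; apply: eq_integral => z _ /=.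
by rewrite ger0_norm ?enorm_ge0.
Qed.

Lemma chebyshev_dist (s : probability (E * E)%type R) (r w eta : R) : 0 < r -> 0 < eta ->
  0 <= w -> 'N[s]_r%:E[dist]%E = w%:E ->
  (s [set z : E * E | (eta < enorm (z.1 - z.2))%R] <= ((w / eta) `^ r)%:E)%E.
Proof.
move=> r0 e0 w0 Nw.
have := Lnorm_dist_powR s (lt0r_neq0 r0); rewrite Nw poweR_EFin => hint.
have mfar := @measurable_far_pairs R d eta.
have : ((eta `^ r)%:E * s [set z : E * E | (eta < enorm (z.1 - z.2))%R] <= (w `^ r)%:E)%E.
  rewrite hint -(integral_cst s mfar) [leLHS]integral_mkcond.
  apply: ge0_le_integral => //.
  - by move=> z _; rewrite patchE; case: ifP => // _; rewrite lee_fin powR_ge0.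
  - by apply: (measurable_restrictT (cst _) mfar).1.
  - by apply/measurable_EFinP; exact: (measurableT_comp (measurable_powR r) (@measurable_dist R d)).
  move=> z _; rewrite patchE; case: ifPn => [|_]; last by rewrite lee_fin powR_ge0.
  rewrite inE/= lee_fin => hz; apply: ler_powR_base; [exact: ltW|exact: ltW|exact: ltW].
have -> : s [set z : E * E | (eta < enorm (z.1 - z.2))%R] =
    (fine (s [set z : E * E | (eta < enorm (z.1 - z.2))%R]))%:E.
  by rewrite fineK// fin_num_measure.
rewrite -EFinM !lee_fin => h.
have er0 : 0 < eta `^ r by rewrite powR_gt0.
have i0 : 0 <= eta^-1 by rewrite invr_ge0 ltW.
by rewrite powRM// -[eta^-1]powR_inv1 ?(ltW e0)// -powRAC powR_inv1 ?powR_ge0// ler_pdivlMr// mulrC.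
Qed.

Lemma far_pairs_Linfty (s : probability (E * E)%type R) (w eta : R) :
  'N[s]_+oo[dist]%E = w%:E -> w <= eta ->
  s [set z : E * E | (eta < enorm (z.1 - z.2))%R] = 0%E.
Proof.
have s1 : (0 < s setT)%E by rewrite probability_setT lte01.
rewrite unlock ifT// => Nw we.
have mfar := @measurable_far_pairs R d eta.
have : {ae s, forall z, (abse \o dist) z <= w%:E}%E by apply/ess_supP; rewrite Nw.
move=> h; apply: measure_negligible => //.
apply: negligibleS h => z /= hz hw; move: hw.
rewrite lee_fin ger0_norm ?enorm_ge0// => hw.
by have := lt_le_trans hz (le_trans hw we); rewrite ltxx.
Qed.

(** Both kinds of norm control the mass of the pairs at distance more than
    [t * D], in the form needed by [optimise_scale]. *)
Lemma far_pairs_Lnorm (s : probability (E * E)%type R) (r : \bar R) (q theta D w : R) :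
  (1 <= r)%E -> 1 <= q -> 0 < theta -> 0 < D -> 0 <= w ->
  'N[s]_r[dist]%E = w%:E ->
  exists2 k, 0 < k & nu_exp q theta r = k * theta / q /\
    forall t, 0 < t -> (w / D) `^ k <= t ->
    (s [set z : E * E | (t * D < enorm (z.1 - z.2))%R] <= ((w / D) `^ (k * theta))%:E)%E.
Proof.
move=> r1 q1 t0 D0 w0 Nw; have q0 : 0 < q by rewrite (lt_le_trans ltr01).
have v0 : 0 <= w / D by rewrite divr_ge0// ltW.
case: r r1 Nw => [r r1 Nw|_ Nw|//].
- rewrite lee_fin in r1; have r0 : 0 < r by rewrite (lt_le_trans ltr01).
  have rt0 : 0 < r + theta by rewrite addr_gt0.
  exists (r / (r + theta)); first by rewrite divr_gt0.
  split; first by rewrite /nu_exp; field; rewrite !gt_eqF.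
  move=> t tp ht; have tD : 0 < t * D by rewrite mulr_gt0.
  apply: (le_trans (chebyshev_dist r0 tD w0 Nw)); rewrite lee_fin.
  have -> : w / (t * D) = (w / D) / t by field; rewrite !gt_eqF.
  have [v_0|vn0] := eqVneq (w / D) 0; first by rewrite v_0 mul0r powR0 ?gt_eqF// powR_ge0.
  have vp : 0 < w / D by rewrite lt_neqAle eq_sym vn0.
  have -> : r / (r + theta) * theta = (1 - r / (r + theta)) * r.
    by field; rewrite gt_eqF.
  rewrite powRrM; apply: ler_powR_base; [exact: ltW|exact: divr_ge0 (ltW tp)|].
  rewrite powRB; last by rewrite vn0 implybT.
  by rewrite powRr1// ler_wpM2l// lef_pV2// posrE powR_gt0.
- exists 1 => //; split; first by rewrite /nu_exp mul1r.
  move=> t tp; rewrite powRr1// => ht.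
  rewrite (far_pairs_Linfty Nw) ?lee_fin ?powR_ge0//.
  by rewrite -ler_pdivrMr.
Qed.

Lemma nu_exp_bounds (q theta : R) (r : \bar R) : (1 <= r)%E -> 1 <= q -> 0 < theta <= 1 ->
  0 < nu_exp q theta r <= 1.
Proof.
move=> r1 q1 /andP[t0 t1]; have q0 : 0 < q by rewrite (lt_le_trans ltr01).
case: r r1 => [r|_|//]; rewrite /nu_exp; last first.
  by rewrite divr_gt0// ler_pdivrMr// mul1r (le_trans t1).
rewrite lee_fin => r1; have r0 : 0 < r by rewrite (lt_le_trans ltr01).
have rt : 0 < q * (r + theta) by rewrite mulr_gt0// addr_gt0.
rewrite (divr_gt0 (mulr_gt0 r0 t0) rt) /= ler_pdivrMr// mul1r.
have r_le : r * theta <= r + theta.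
  by rewrite (@le_trans _ _ r)// ?lerDl ?ler_piMr// ltW.
by rewrite (le_trans r_le)// ler_peMl//; exact: addr_ge0 (ltW r0) (ltW t0).
Qed.

(** The number [w] is chosen so that [C * w `^ nu] exceeds the value at the
    infimum by exactly [e], and the set has an element below [w]. *)
Lemma ereal_inf_powR_bound (S : set (\bar R)) (W0 : \bar R) (A C nu : R) :
  0 < C -> 0 < nu -> (forall N, S N -> 0 <= N)%E ->
  (forall N, S N -> W0 <= A%:E + C%:E * N `^ nu)%E ->
  (W0 <= A%:E + C%:E * ereal_inf S `^ nu)%E.
Proof.
move=> C0 nu0 S0 hS.
have i0 : (0 <= ereal_inf S)%E by apply: le_ereal_inf_tmp => N /S0.
have [iy|iy] := eqVneq (ereal_inf S) +oo%E.
  by rewrite iy poweRyr ?gt_eqF// gt0_muley// addey// leey.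
have : ereal_inf S \is a fin_num by rewrite ge0_fin_numE// ltey.
move: i0; case E : (ereal_inf S) => [i| |] // i0 _; rewrite lee_fin in i0.
rewrite poweR_EFin -EFinM -EFinD; apply/lee_addgt0Pr => e e0.
pose w := (i `^ nu + e / C) `^ nu^-1.
have b0 : 0 <= i `^ nu + e / C by rewrite addr_ge0 ?powR_ge0// divr_ge0// ltW.
have wE : w `^ nu = i `^ nu + e / C by rewrite -powRrM mulVf ?gt_eqF// powRr1.
have iw : i < w.
  rewrite ltNge; apply/negP => wi.
  have : w `^ nu <= i `^ nu by apply: ler_powR_base => //; rewrite ?powR_ge0// ltW.
  by rewrite wE gerDl leNgt divr_gt0.
have /ereal_inf_lt[N SN Nw] : (ereal_inf S < w%:E)%E by rewrite E lte_fin.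
apply: (le_trans (hS N SN)); have N0 := S0 N SN.
case: N SN Nw N0 => [N| |] // SN Nw N0; rewrite lte_fin in Nw; rewrite lee_fin in N0.
rewrite poweR_EFin -EFinM -!EFinD lee_fin -addrA lerD2l.
apply: (@le_trans _ _ (C * w `^ nu)); last by rewrite wE mulrDr mulrCA mulfV ?gt_eqF// mulr1.
by rewrite ler_pM2l// ler_powR_base// ltW.
Qed.

End Assembly.

(** * Optimising the scale *)

Section Stability.
Context {R : realType} {d : nat}.
Local Notation E := 'rV[R]_d.
Local Notation dist := (fun z : E * E => (enorm (z.1 - z.2))%:E : \bar R).
Variables (q M theta : R) (r : \bar R) (X Y : set E) (B DX DY : R) (x0 : E).
Variables (rho rhot mu : probability E R) (go g : probability (E * E)%type R).
Variables (phi psi : E -> R) (delta e : R).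
Hypothesis d2 : (2 <= d)%N.
Hypothesis q1 : 1 <= q.
Hypothesis r1 : (1 <= r)%E.
Hypothesis M0 : 0 < M.
Hypothesis theta01 : 0 < theta <= 1.
Hypothesis B0 : 0 <= B.
Hypothesis hY : forall y, Y y -> enorm y <= B.
Hypothesis hDX : forall x, X x -> enorm (x - x0) <= DX.
Hypothesis hDY : forall y y', Y y -> Y y' -> enorm (y - y') <= DY.
Hypothesis DY0 : 0 < DY.
Hypothesis X0 : X x0.
Hypothesis mX : measurable X.
Hypothesis mY : measurable Y.
Hypothesis rhotX : rhot X = 1%E.
Hypothesis muY : mu Y = 1%E.
Hypothesis hball : forall (x : E) (eta : R), 0 < eta ->
  (rhot (eball x eta) <= (M * eta `^ (d%:R - 1 + theta))%:E)%E.
Hypothesis pp : potential_pair Y phi psi.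
Hypothesis psi_lip : forall y y', psi y - psi y' <= B * enorm (y - y').
Hypothesis cgo : couplings rho mu go.
Hypothesis cg : couplings rho mu g.
Hypothesis go0 : {ae go, forall p, gap phi psi p.1 p.2 = 0}.
Hypothesis e_int : (\int[g]_p (gap_pos phi psi p)%:E = e%:E)%E.
Hypothesis e_ge0 : 0 <= e.
Hypothesis e_delta : 2 * e <= delta.

Let A := c_const d * M * DX `^ (d%:R - 1 + theta).
Let s := theta / (1 + theta).
Let cost : \bar R := ereal_inf
  [set \int[pi]_z (enorm (z.1.1 - z.2.1) `^ q + enorm (z.1.2 - z.2.2) `^ q)%R%:E
  | pi in couplings go g]%E.

Let q0 : 0 < q. Proof. exact: lt_le_trans ltr01 q1. Qed.
Let theta0 : 0 < theta. Proof. by have /andP[] := theta01. Qed.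
Let DX0 : 0 < DX.
Proof. by have [] := measure_diam d2 hDX mX M0 theta01 rhotX X0 hball. Qed.
Let c_ge : 24 * d%:R ^+ 2 * (d%:R + 1) <= c_const d :> R. Proof. exact: c_const_ge. Qed.
Let A0 : 0 <= A.
Proof.
have c0 : 0 <= c_const d :> R by exact: le_trans ler01 (c_ge1 d2 c_ge).
exact: mulr_ge0 (mulr_ge0 c0 (ltW M0)) (powR_ge0 _ _).
Qed.
Let delta0 : 0 <= delta. Proof. by rewrite (le_trans _ e_delta)// mulr_ge0. Qed.

Let cost_ge0 : (0 <= cost)%E.
Proof.
apply: le_ereal_inf_tmp => _ [pi _ <-]; apply: integral_ge0 => z _.
by rewrite lee_fin addr_ge0// powR_ge0.
Qed.

(** The scale is measured in units of [DX]. *)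
Let cost_le (sigma : probability (E * E)%type R) (f t : R) : couplings rho rhot sigma ->
  0 < t -> (sigma [set z : E * E | (t * DX < enorm (z.1 - z.2))%R] <= f%:E)%E ->
  (cost <= (DY `^ q * (delta / (DY * DX) / (2 * t) + f + A * t `^ theta))%:E)%E.
Proof.
move=> csigma t0 hf; have eta0 : 0 < t * DX by rewrite mulr_gt0.
apply: (le_trans (plan_distance_le hY B0 hDY (ltW DY0) pp psi_lip mY muY q1 eta0 cgo cg go0)).
rewrite e_int; have k0 : 0 <= DY `^ (q - 1) by exact: powR_ge0.
have h1 := osc2_integral_le d2 hY hDX hDY (ltW DY0) pp mX M0 theta01 c_ge rhotX X0 hball csigma eta0.
have tE : t * DX / DX = t by rewrite mulfK// gt_eqF.
rewrite tE in h1.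
have h2 := le_trans h1 (leeD2r _ (lee_wpmul2l (_ : 0 <= DY%:E)%E hf)).
have {}h2 := h2 (ltW DY0 : (0 <= DY%:E)%E).
apply: (@le_trans _ _ ((DY `^ (q - 1))%:E * (((t * DX)^-1 * e)%:E + (DY * f + DY * (A * t `^ theta))%:E))%E).
  by rewrite lee_wpmul2l ?lee_fin// leeD2l// EFinD EFinM.
rewrite -EFinD -EFinM lee_fin -(mulr_powRB1 (ltW DY0) q0).
rewrite [DY * DY `^ _]mulrC -[leRHS]mulrA ler_wpM2l//.
rewrite (_ : DY * (delta / (DY * DX) / (2 * t) + f + A * t `^ theta) =
  delta / (2 * (t * DX)) + (DY * f + DY * (A * t `^ theta))); last first.
  by field; rewrite !gt_eqF.
rewrite lerD2r mulrC ler_pdivrMr//.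
rewrite (_ : delta / _ * _ = delta / 2); last by field; rewrite !gt_eqF.
by rewrite ler_pdivlMr// mulrC.
Qed.

Let u := delta / (DY * DX).

Let u_ge0 : 0 <= u. Proof. by rewrite divr_ge0// mulr_ge0// ltW. Qed.

(** The bound for the distance to [rhot] along one coupling [sigma]: optimise
    the scale, then take the [q]-th root, which is subadditive. *)
Lemma plan_bound_coupling (sigma : probability (E * E)%type R) : couplings rho rhot sigma ->
  (W_plans q go g <= (C0_const d q theta M DX DY * delta `^ (theta / (q * (1 + theta))))%:E
    + (C1_const d q theta M DX DY r)%:E * 'N[sigma]_r[dist] `^ nu_exp q theta r)%E.
Proof.
move=> csigma; have /andP[nu0 nu1] := nu_exp_bounds r1 q1 theta01.
have K1 : 0 < A + 1 by rewrite ltr_wpDl.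
have C1_gt0 : 0 < C1_const d q theta M DX DY r.
  by rewrite /C1_const -/A !mulr_gt0// powR_gt0.
have [Ny|Ny] := eqVneq ('N[sigma]_r[dist])%E +oo%E.
  by rewrite Ny poweRyr ?gt_eqF// gt0_muley// addey// leey.
have N0 := Lnorm_ge0 sigma r dist.
have : ('N[sigma]_r[dist])%E \is a fin_num by rewrite ge0_fin_numE// ltey.
case Nw : ('N[sigma]_r[dist])%E N0 => [w| |] // w0 _; rewrite lee_fin in w0.
have [k k0 [nuE hfar]] := far_pairs_Lnorm r1 q1 theta0 DX0 w0 Nw.
pose v := w / DX; have v_ge0 : 0 <= v by rewrite divr_ge0// ltW.
have cost_t t : 0 < t -> v `^ k <= t ->
    (cost <= (DY `^ q * (u / (2 * t) + v `^ (k * theta) + A * t `^ theta))%:E)%E.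
  by move=> t0 vt; exact: cost_le csigma t0 (hfar t t0 vt).
have cost_fin : cost \is a fin_num.
  rewrite ge0_fin_numE//; apply: le_lt_trans (ltry _).
  apply: (cost_t (Num.max 1 (v `^ k))); first by rewrite lt_max ltr01.
  by rewrite le_max lexx orbT.
pose I := fine cost / DY `^ q.
have Dq0 : 0 < DY `^ q by rewrite powR_gt0.
have costE : cost = (DY `^ q * I)%:E by rewrite /I mulrCA mulfV ?gt_eqF// mulr1 fineK.
have hI : I <= (1 + A) * (u `^ s + v `^ (k * theta)).
  apply: optimise_scale => // t t0 vt.
  by have := cost_t t t0 vt; rewrite costE lee_fin ler_pM2l.
have I0 : 0 <= DY `^ q * I by rewrite -lee_fin -costE.
have qi : 0 < q^-1 <= 1 by rewrite invr_gt0 q0 invf_le1.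
have P0 : 0 <= DY `^ q * (1 + A) by rewrite mulr_ge0 ?powR_ge0// addr_ge0.
rewrite /W_plans -/cost costE !poweR_EFin -EFinM -EFinD lee_fin.
apply: (@le_trans _ _ ((DY `^ q * (1 + A) * u `^ s + DY `^ q * (1 + A) * v `^ (k * theta)) `^ q^-1)).
  apply: ler_powR_base => //; first by rewrite invr_ge0 ltW.
  by rewrite -mulrDr -mulrA ler_pM2l.
apply: (le_trans (powR_subadd qi (mulr_ge0 P0 (powR_ge0 _ _)) (mulr_ge0 P0 (powR_ge0 _ _)))).
have DD0 : 0 <= DY * DX by rewrite mulr_ge0// ltW.
have powV (x y : R) : 0 <= x -> x^-1 `^ y = x `^ (- y).
  by move=> x_ge0; rewrite -powR_inv1// -powRrM mulN1r.
apply: lerD; rewrite le_eqVlt; apply/orP; left; apply/eqP.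
- have -> : theta / (q * (1 + theta)) = s * q^-1.
    by rewrite /s; field; rewrite !gt_eqF// addr_gt0.
  have -> : C0_const d q theta M DX DY =
    (DY `^ q * (1 + A) * (DY * DX) `^ (- s)) `^ q^-1 by [].
  have a1 : 0 <= DY `^ q * (1 + A) * (DY * DX) `^ (- s) by rewrite mulr_ge0// powR_ge0.
  rewrite (powRrM delta) -(powRM _ a1 (powR_ge0 _ _)).
  congr (_ `^ _); rewrite -[RHS]mulrA; congr (_ * _).
  have i1 : 0 <= (DY * DX)^-1 by rewrite invr_ge0.
  by rewrite /u (powRM _ delta0 i1) (powV _ _ DD0) mulrC.
- have -> : C1_const d q theta M DX DY r =
    DY * (A + 1) `^ q^-1 * DX `^ (- nu_exp q theta r) by [].
  have a1 : 0 <= 1 + A by rewrite addr_ge0.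
  rewrite (powRM _ P0 (powR_ge0 _ _)) (powRM _ (powR_ge0 _ _) a1).
  rewrite -(powRrM DY) mulfV ?gt_eqF// (powRr1 (ltW DY0)) -(powRrM v) -nuE (addrC 1).
  have i1 : 0 <= DX^-1 by rewrite invr_ge0 ltW.
  by rewrite /v (powRM _ w0 i1) (powV _ _ (ltW DX0)) [w `^ _ * _]mulrC mulrA.
Qed.

End Stability.

(** * The stability theorem *)

Section OptimalPlans.
Context {R : realType} {d : nat}.
Local Notation E := 'rV[R]_d.
Variables (X Y : set E) (rho mu : probability E R) (B : R).
Hypothesis mX : measurable X.
Hypothesis mY : measurable Y.
Hypothesis rhoX : rho X = 1%E.
Hypothesis muY : mu Y = 1%E.
Hypothesis hX : forall x, X x -> enorm x <= B.
Hypothesis hY : forall y, Y y -> enorm y <= B.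

(** Kantorovich duality for the optimal plan: it is carried by the contact set
    of its potentials. *)
Lemma optimal_plan_potentials (go : probability (E * E)%type R) :
  optimal_plans rho mu go ->
  exists phi psi, [/\ potential_pair Y phi psi,
    forall y y', psi y - psi y' <= B * enorm (y - y') &
    {ae go, forall p, gap phi psi p.1 p.2 = 0}].
Proof.
move=> hopt; have aeS := plan_support_ae mX mY rhoX muY hopt.1.
have [p0 Sp0] : exists p, plan_support X Y go p.
  apply/not_existsP => noS.
  have [N [mN N0 hN]] := aeS.
  have NT : N = setT by apply/seteqP; split=> // p _; apply: hN => /= /noS.
  by move: N0; rewrite NT probability_setT => /eqP; rewrite onee_eq0.
have SXY : plan_support X Y go `<=` X `*` Y by move=> p [].
have [phi [psi [pp eqS lip]]] := rockafellar hX hY SXY Sp0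
  (optimal_plan_cyclically_monotone mX mY rhoX muY hX hY hopt).
exists phi, psi; split => //; apply: filterS aeS => p Sp.
by rewrite /gap eqS// subrr.
Qed.

Lemma integral_setX_plan (g : probability (E * E)%type R) : couplings rho mu g ->
  (\int[g]_(z in X `*` Y) (enorm (z.1 - z.2) ^+ 2)%:E = quad_cost g)%E.
Proof.
move=> cg; rewrite integral_mkcond; apply: ae_eq_integral => //.
- apply/(measurable_restrictT _ (measurableX mX mY)).
  by apply: measurable_funTS; exact: measurable_sqdist.
- exact: measurable_sqdist.
have := plan_support_ae mX mY rhoX muY cg; apply: filterS => p [Xp Yp _] _.
by rewrite patchE mem_set.
Qed.

Lemma W2_sqr_le (g : probability (E * E)%type R) : couplings rho mu g ->
  (0 <= W 2%:E rho mu ^+ 2 <= quad_cost g)%E.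
Proof.
move=> cg; set w := W _ _ _.
have w0 : (0 <= w)%E by apply: le_ereal_inf_tmp => _ [s _ <-]; exact: Lnorm_ge0.
have sqrE (x : \bar R) : (x ^+ 2 = x * x)%E by [].
rewrite sqrE mule_ge0//=.
set N := ('N[g]_2%:E[(fun z : E * E => (enorm (z.1 - z.2))%:E)])%E.
have wN : (w <= N)%E by apply: ereal_inf_lbound; exists g.
apply: (le_trans (lee_pmul w0 w0 wN wN)).
have N2 : (N `^ 2 = quad_cost g)%E.
  rewrite /N Lnorm_dist_powR//; apply: eq_integral => z _.
  by rewrite powR_mulrn// enorm_ge0.
rewrite -N2; have : (0 <= N)%E by exact: Lnorm_ge0.
case: N {wN N2} => [x| |] //.
  by rewrite lee_fin => x0; rewrite poweR_EFin powR_mulrn// lee_fin.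
by rewrite poweRyr// leey.
Qed.

End OptimalPlans.

(** With a one-point target the oscillation term vanishes, and the gap term,
    being divided by [eta], is arbitrarily small for large [eta]. *)
Lemma W_plans_degenerate {R : realType} {d : nat} (Y : set 'rV[R]_d)
    (phi psi : 'rV[R]_d -> R) (B q e : R) (rho mu : probability 'rV[R]_d R)
    (go g : probability ('rV[R]_d * 'rV[R]_d)%type R) :
  (forall y, Y y -> enorm y <= B) -> 0 <= B ->
  (forall y y', Y y -> Y y' -> enorm (y - y') <= 0) ->
  potential_pair Y phi psi ->
  (forall y y', psi y - psi y' <= B * enorm (y - y')) ->
  measurable Y -> mu Y = 1%E -> 1 <= q ->
  couplings rho mu go -> couplings rho mu g ->
  {ae go, forall p, gap phi psi p.1 p.2 = 0} ->
  (\int[g]_p (gap_pos phi psi p)%:E = e%:E)%E -> 0 <= e ->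
  W_plans q go g = 0%E.
Proof.
move=> hY B0 hD pp lip mY muY q1 cgo cg go0 eE e0.
have q0 : q^-1 != 0 by rewrite invr_eq0 gt_eqF// (lt_le_trans ltr01).
rewrite /W_plans; set cost := ereal_inf _.
suff -> : cost = 0%E by rewrite poweR0r.
apply/eqP; rewrite eq_le; apply/andP; split; last first.
  apply: le_ereal_inf_tmp => _ [pi _ <-]; apply: integral_ge0 => z _.
  by rewrite lee_fin addr_ge0// powR_ge0.
apply/lee_addgt0Pr => t t0; rewrite add0e.
pose K := (0 : R) `^ (q - 1); have K0 : 0 <= K by exact: powR_ge0.
pose eta := (K * e + 1) / t.
have Ke : 0 < K * e + 1 by rewrite ltr_wpDl// mulr_ge0.
have eta0 : 0 < eta by rewrite divr_gt0.
apply: (le_trans (plan_distance_le hY B0 hD (lexx 0) pp lip mY muY q1 eta0 cgo cg go0)).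
rewrite eE integral0_eq ?adde0; last first.
  move=> x _; congr EFin; apply/min_idPl.
  by rewrite divr_ge0 ?(ltW eta0)//; apply: (osc2_ge0 hY pp); exact: ltW.
rewrite -!EFinM lee_fin /eta invf_div -/K.
rewrite (_ : K * (t / (K * e + 1) * e) = t * (K * e / (K * e + 1))); last by ring.
by rewrite ler_piMr ?(ltW t0)// ler_pdivrMr// mul1r lerDl.
Qed.

Theorem theorem4p4 (R : realType) (d : nat) (q : R) (r : \bar R)
    (X Y : set 'rV[R]_d) (M theta : R) (rhot : probability 'rV[R]_d R)
    (hd : (2 <= d)%N) (hq : 1 <= q) (hr : (1 <= r)%E)
    (cX : compact X) (cvxX : convex_set X)
    (cY : compact Y) (cvxY : convex_set Y)
    (hM : 0 < M) (htheta : 0 < theta <= 1)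
    (hrhot : prob_on X rhot)
    (hball : forall (x : 'rV[R]_d) (eta : R), 0 < eta ->
       (rhot (eball x eta) <= (M * eta `^ (d%:R - 1 + theta))%:E)%E)
    (rho mu : probability 'rV[R]_d R)
    (hrho : prob_on X rho) (hmu : prob_on Y mu)
    (gamma_opt gamma : probability ('rV[R]_d * 'rV[R]_d)%type R)
    (hopt : optimal_plans rho mu gamma_opt)
    (hgamma : couplings rho mu gamma) :
  0 < nu_exp q theta r <= 1 /\
  (W_plans q gamma_opt gamma <=
     (C0_const d q theta M (diam X) (diam Y))%:E *
       (\int[gamma]_(z in X `*` Y) (enorm (z.1 - z.2) ^+ 2)%:E
          - W 2%:E rho mu ^+ 2) `^ (theta / (q * (1 + theta)))
     + (C1_const d q theta M (diam X) (diam Y) r)%:E *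
         W r rho rhot `^ (nu_exp q theta r))%E.
Proof.
have nu01 := nu_exp_bounds hr hq htheta; split=> //.
have mX := rV_compact_measurable cX; have mY := rV_compact_measurable cY.
have [BX BX0 hBX] := compact_enorm_bounded cX.
have [BY BY0 hBY] := compact_enorm_bounded cY.
pose B := Num.max BX BY.
have B0 : 0 <= B by rewrite le_max BX0.
have hX x : X x -> enorm x <= B by move=> /hBX h; rewrite le_max h.
have hY y : Y y -> enorm y <= B by move=> /hBY h; rewrite le_max h orbT.
have [x0 Xx0] := probability_nonempty hrho.
have [y0 Yy0] := probability_nonempty hmu.
have hDX x : X x -> enorm (x - x0) <= diam X by move=> Xx; exact: dist_le_diam.
have hDY y y' : Y y -> Y y' -> enorm (y - y') <= diam Y by exact: dist_le_diam.
have DY0 : 0 <= diam Y by rewrite (le_trans (enorm_ge0 (y0 - y0)))// hDY.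
have cgo := hopt.1.
have [phi [psi [pp lip go0]]] :=
  optimal_plan_potentials mX mY hrho hmu hX hY hopt.
rewrite (integral_setX_plan mX mY hrho hmu hgamma).
have gfin := quad_cost_fin mX mY hrho hmu hX hY hgamma.
have gofin := quad_cost_fin mX mY hrho hmu hX hY cgo.
have /andP[w2_ge0 w2_le] := W2_sqr_le cgo.
have hg := quad_cost_gap mX mY hrho hmu hX hY pp lip cgo hgamma go0.
have ge0 : (0 <= \int[gamma]_p (gap_pos phi psi p)%:E)%E.
  by apply: integral_ge0 => p _; rewrite lee_fin gap_pos_ge0.
have {}hg : (quad_cost gamma = quad_cost gamma_opt
    + 2%:E * \int[gamma]_p (gap_pos phi psi p)%:E)%E.
  rewrite hg -ge0_integralZl//; last by move=> p _; rewrite lee_fin gap_pos_ge0.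
  by apply/measurable_EFinP; exact: (measurable_gap_pos hY pp lip).
have w2_fin := le_lt_trans w2_le gofin.
have : (0 <= quad_cost gamma_opt)%E.
  by apply: integral_ge0 => p _; rewrite lee_fin sqr_ge0.
case Ew : (W 2%:E rho mu ^+ 2)%E w2_ge0 w2_le w2_fin => [w2| |] // _ w2_le _.
case Eo : (quad_cost gamma_opt) hg gofin w2_le => [Jo| |] // hg _ w2_le Jo0.
rewrite lee_fin in w2_le.
case eE : (\int[gamma]_p _)%E ge0 hg => [e| |] // ge0 hg; last first.
  by move: gfin; rewrite hg gt0_muley.
rewrite lee_fin in ge0.
pose delta := Jo + 2 * e - w2.
have -> : (quad_cost gamma - w2%:E = delta%:E)%E by rewrite hg.
have e_delta : 2 * e <= delta by rewrite /delta -addrA addrCA lerDl subr_ge0.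
have [DYpos|DYz] := ltP 0 (diam Y); last first.
  have hDYz y y' : Y y -> Y y' -> enorm (y - y') <= 0.
    by move=> Yy Yy'; exact: le_trans (hDY y y' Yy Yy') DYz.
  rewrite (W_plans_degenerate hY B0 hDYz pp lip mY hmu hq cgo hgamma go0 eE ge0).
  apply: adde_ge0; apply: mule_ge0; rewrite ?poweR_ge0// lee_fin ?powR_ge0//.
  by rewrite !mulr_ge0// powR_ge0.
have [DX0 _] := measure_diam hd hDX mX hM htheta hrhot Xx0 hball.
have A0 : 0 <= c_const d * M * diam X `^ (d%:R - 1 + theta).
  have c0 : 0 <= c_const d :> R by exact: le_trans ler01 (c_ge1 hd (c_const_ge hd)).
  exact: mulr_ge0 (mulr_ge0 c0 (ltW hM)) (powR_ge0 _ _).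
have /andP[nu0 _] := nu01.
have C1_gt0 : 0 < C1_const d q theta M (diam X) (diam Y) r.
  by rewrite /C1_const !mulr_gt0// powR_gt0// ltr_wpDl.
rewrite poweR_EFin -EFinM; apply: ereal_inf_powR_bound => //.
  by move=> _ [s _ <-]; exact: Lnorm_ge0.
move=> _ [s cs <-].
exact: (plan_bound_coupling hd hq hr hM htheta B0 hY hDX hDY DYpos Xx0 mX mY
  hrhot hmu hball pp lip cgo hgamma go0 eE ge0 e_delta cs).
Qed.
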